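(* As $a \to \infty$ through the positive integers, $$R(7,a) = \tfrac{35406319}{3628800}a^6 - \tfrac{205303771}{604800}a^5 + \tfrac{986460817}{181440}a^4 - \tfrac{908874965}{18144}a^3 + O(a^2).$$
   Context: A finite lattice is graded of rank $3$ if every maximal chain (from bottom to top) has exactly four elements; its elements then lie on four levels: the bottom, the atoms (elements covering the bottom), the coatoms (elements covered by the top), and the top. For integers $c, a \ge 1$, $R(c,a)$ denotes the number of unlabeled graded lattices of rank $3$ (that is, the number of isomorphism classes of such lattices) with exactly $c$ coatoms and exactly $a$ atoms. *)

(* Defs.v *)
From mathcomp Require Import all_boot fingroup perm.

Set Implicit Arguments.
Unset Strict Implicit.
Unset Printing Implicit Defensive.

Definition order_relation (T : finType) (r : rel T) : bool :=
  [&& [forall x, r x x],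
      [forall x, forall y, r x y && r y x ==> (x == y)] &
      [forall x, forall y, forall z, r x y && r y z ==> r x z]].

Definition is_glb (T : finType) (r : rel T) (x y m : T) : bool :=
  [&& r m x, r m y & [forall z, r z x && r z y ==> r z m]].

Definition is_lub (T : finType) (r : rel T) (x y j : T) : bool :=
  [&& r x j, r y j & [forall z, r x z && r y z ==> r j z]].

Definition lattice_relation (T : finType) (r : rel T) : bool :=
  order_relation r &&
  [forall x, forall y, [exists m, is_glb r x y m] && [exists j, is_lub r x y j]].

Definition is_bottom (T : finType) (r : rel T) (b : T) : bool :=
  [forall x, r b x].

Definition is_top (T : finType) (r : rel T) (t : T) : bool :=
  [forall x, r x t].

(* [covered_by r x y]: x < y and no z satisfies x < z < y. *)
Definition covered_by (T : finType) (r : rel T) (x y : T) : bool :=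
  [&& x != y, r x y &
      [forall z, r x z && r z y ==> (z == x) || (z == y)]].

Definition atoms (T : finType) (r : rel T) : {set T} :=
  [set x | [exists b, is_bottom r b && covered_by r b x]].

Definition coatoms (T : finType) (r : rel T) : {set T} :=
  [set x | [exists t, is_top r t && covered_by r x t]].

Definition is_chain (T : finType) (r : rel T) (C : {set T}) : bool :=
  [forall x in C, forall y in C, r x y || r y x].

Definition graded_rank3 (T : finType) (r : rel T) : bool :=
  [forall C : {set T}, maxset (is_chain r) C ==> (#|C| == 4)].

Definition rank3_lattice (c a : nat) (T : finType) (r : rel T) : bool :=
  [&& lattice_relation r, graded_rank3 r,
      #|coatoms r| == c & #|atoms r| == a].

Definition rel_of (T : finType) (E : {set T * T}) : rel T :=
  fun x y => (x, y) \in E.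

Definition isomorphic (T : finType) (E F : {set T * T}) : bool :=
  [exists f : {perm T}, forall x, forall y,
     rel_of E x y == rel_of F (f x) (f y)].

(* A graded lattice of rank 3 with c coatoms and a atoms has exactly c + a + 2
   elements (lemma [card_rank3_lattice] below), so every isomorphism class is
   represented on the carrier 'I_(c + a + 2). *)
Definition labeled_rank3_lattices (c a : nat) :
    {set {set 'I_(c + a + 2) * 'I_(c + a + 2)}} :=
  [set E | rank3_lattice c a (rel_of E)].

Definition nb_rank3_lattices (c a : nat) : nat :=
  #|equivalence_partition (@isomorphic 'I_(c + a + 2))
                          (labeled_rank3_lattices c a)|.

Lemma isomorphic_equiv (T : finType) : equivalence_rel (@isomorphic T).
Proof.
apply/equivalence_relP; split=> [E|].
  by apply/existsP; exists 1%g; apply/forallP=> x; apply/forallP=> y; rewrite !perm1.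
move=> E F /existsP[f /forallP fP] G.
have {}fP x y : rel_of E x y = rel_of F (f x) (f y).
  by move/forallP: (fP x) => /(_ y) /eqP.
apply/existsP/existsP => -[g /forallP gP].
  exists (f^-1 * g)%g; apply/forallP => x; apply/forallP => y; rewrite !permM.
  move/forallP: (gP (f^-1 x)%g) => /(_ (f^-1 y)%g) /eqP <-.
  by rewrite fP !permKV.
exists (f * g)%g; apply/forallP => x; apply/forallP => y; rewrite !permM fP.
by move/forallP: (gP (f x)) => /(_ (f y)).
Qed.

Lemma bottom_exists (T : finType) (r : rel T) :
  lattice_relation r -> forall x0 : T, exists b, is_bottom r b.
Proof.
case/andP=> /and3P[/forallP rr _ /forallP rt] /forallP L x0.
have tr x y z : r x y -> r y z -> r x z.
  by move=> xy yz; move/forallP: (rt x) => /(_ y) /forallP /(_ z); rewrite xy yz.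
suff [b hb] : exists b, all (r b) (enum T).
  exists b; apply/forallP => x; move/allP: hb; apply; exact: mem_enum.
elim: (enum T) => [|x s [b hb]]; first by exists x0.
move/forallP: (L x) => /(_ b) /andP[/existsP[m /and3P[mx mb _]] _].
exists m; rewrite /= mx; apply/allP => y ys.
by apply: tr mb _; move/allP: hb; apply.
Qed.

Lemma top_exists (T : finType) (r : rel T) :
  lattice_relation r -> forall x0 : T, exists t, is_top r t.
Proof.
case/andP=> /and3P[/forallP rr _ /forallP rt] /forallP L x0.
have tr x y z : r x y -> r y z -> r x z.
  by move=> xy yz; move/forallP: (rt x) => /(_ y) /forallP /(_ z); rewrite xy yz.
suff [b hb] : exists b, all (fun x => r x b) (enum T).
  exists b; apply/forallP => x; move/allP: hb; apply; exact: mem_enum.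
elim: (enum T) => [|x s [b hb]]; first by exists x0.
move/forallP: (L x) => /(_ b) /andP[_ /existsP[m /and3P[xm bm _]]].
exists m; rewrite /= xm; apply/allP => y ys.
by apply: tr _ bm; move/allP: hb; apply.
Qed.

Lemma chain_seqP (T : finType) (r : rel T) (s : seq T) :
  all (fun x => all (fun y => r x y || r y x) s) s ->
  is_chain r [set x in s].
Proof.
move=> /allP h; apply/forall_inP => x; rewrite inE => xs.
apply/forall_inP => y; rewrite inE => ys.
by move/allP: (h x xs); apply.
Qed.

Lemma chain_le4 (T : finType) (r : rel T) (s : seq T) :
  graded_rank3 r -> uniq s ->
  all (fun x => all (fun y => r x y || r y x) s) s -> size s <= 4.
Proof.
move=> /forallP g us /chain_seqP /maxset_exists[C mC sC].
move: (g C); rewrite mC => /eqP <-.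
by apply: leq_trans (subset_leq_card sC); rewrite cardsE (card_uniqP us).
Qed.

Lemma chain_extend (T : finType) (r : rel T) (s : seq T) :
  graded_rank3 r -> uniq s -> size s < 4 ->
  all (fun x => all (fun y => r x y || r y x) s) s ->
  exists2 y, y \notin s & all (fun x => r x y || r y x) s.
Proof.
move=> /forallP g us s4 /chain_seqP /maxset_exists[C mC sC].
move: (g C); rewrite mC => /eqP C4.
have : ~~ (C \subset [set x in s]).
  apply/negP => /subset_leq_card; rewrite C4 cardsE (card_uniqP us).
  by rewrite leqNgt s4.
case/subsetPn=> y yC; rewrite inE => ys; exists y => //.
apply/allP => x xs.
have xC : x \in C by apply: (subsetP sC); rewrite inE.
by case/maxsetP: mC => /forall_inP /(_ x xC) /forall_inP /(_ y yC).
Qed.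

Lemma card_rank3_lattice (c a : nat) (T : finType) (r : rel T) :
  rank3_lattice c a r -> #|T| = c + a + 2.
Proof.
case/and4P=> L g /eqP <- /eqP <-.
have [x0 _ _] := chain_extend (s := [::]) g isT isT isT.
have [b /forallP bP] := bottom_exists L x0.
have [t /forallP tP] := top_exists L x0.
case/andP: L => /and3P[/forallP rr /forallP ra /forallP rt] _.
have tr x y z : r x y -> r y z -> r x z.
  by move=> xy yz; move/forallP: (rt x) => /(_ y) /forallP /(_ z); rewrite xy yz.
have an x y : r x y -> r y x -> x = y.
  by move=> xy yx; move/forallP: (ra x) => /(_ y); rewrite xy yx => /eqP.
have bt : b != t.
  apply/eqP => e; have := chain_extend (s := [:: b]) g isT isT.
  rewrite /= rr => /(_ isT)[y]; rewrite inE => /eqP; case.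
  by apply: an; rewrite ?e ?tP // -e bP.
(* three-element chains b < x < t are not maximal *)
have mid x : x != b -> x != t -> exists2 y, [&& y != x, y != b & y != t] &
    r x y || r y x.
  move=> xb xt; have := chain_extend (s := [:: b; x; t]) g.
  rewrite /= !inE !bP !tP !rr eq_sym (negPf xb) (negPf bt) (negPf xt) !orbT /=.
  case=> // y; rewrite !inE !negb_or => /and3P[h1 h2 h3] /and4P[_ h _ _].
  by exists y; rewrite ?h1 ?h2 ?h3.
have five x y z : b != x -> x != y -> y != z -> z != t -> 
    r x y -> r y z -> False.
  move=> bx xy yz zt rxy ryz.
  have rxz := tr _ _ _ rxy ryz.
  have xz : x != z.
    by apply/eqP => e; move/eqP: xy; apply; apply: an; rewrite // e.
  have xt : x != t.
    by apply/eqP => e; move/eqP: zt; apply; apply: an; rewrite // -e.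
  have yt : y != t.
    by apply/eqP => e; move/eqP: zt; apply; apply: an; rewrite // -e.
  have yb : b != y.
    by apply/eqP => e; move/eqP: bx; apply; apply: an; rewrite // e.
  have zb : b != z.
    by apply/eqP => e; move/eqP: bx; apply; apply: an; rewrite // e.
  have := chain_le4 (s := [:: b; x; y; z; t]) g.
  rewrite /= !inE !negb_or bx xy yz zt xz xt yt yb zb bt !bP !tP !rr.
  by rewrite rxy ryz rxz !orbT => /(_ isT isT).
have botE b' : is_bottom r b' -> b' = b.
  by move=> /forallP h; apply: an.
have topE t' : is_top r t' -> t' = t.
  by move=> /forallP h; apply: an.
have atE x : (x \in atoms r) = covered_by r b x.
  rewrite inE; apply/existsP/idP => [[b' /andP[/botE ->]]//|h].
  by exists b; rewrite h andbT; apply/forallP.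
have coE x : (x \in coatoms r) = covered_by r x t.
  rewrite inE; apply/existsP/idP => [[b' /andP[/topE ->]]//|h].
  by exists t; rewrite h andbT; apply/forallP.
have atP x : x != b -> x != t ->
    (x \in atoms r) = ~~ (x \in coatoms r).
  move=> xb xt; rewrite atE coE.
  have [y /and3P[yx yb yt] xy] := mid x xb xt.
  rewrite /covered_by bP tP xt eq_sym xb /=.
  case/orP: xy => xy.
  - have -> : [forall z, r x z && r z t ==> (z == x) || (z == t)] = false.
      apply/negbTE/forallPn; exists y.
      by rewrite xy tP (negPf yx) (negPf yt).
    apply/forallP => z; rewrite bP /=; apply/implyP => zx.
    apply/negPn/negP; rewrite negb_or => /andP[zb zx'].
    by apply: (five z x y); rewrite // 1?eq_sym.
  - have -> : [forall z, r b z && r z x ==> (z == b) || (z == x)] = false.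
      apply/negbTE/forallPn; exists y.
      by rewrite xy bP (negPf yx) (negPf yb).
    apply/esym/negPn/forallP => z; rewrite tP andbT; apply/implyP => zx.
    apply/negPn/negP; rewrite negb_or => /andP[zb zx'].
    by apply: (five y x z); rewrite // 1?eq_sym.
have bA : b \notin atoms r by rewrite atE /covered_by eqxx.
have tC : t \notin coatoms r by rewrite coE /covered_by eqxx.
have [y yb ybt] : exists2 y, y != b & y != t.
  have := chain_extend (s := [:: b; t]) g.
  rewrite /= !inE !bP !tP bt !orbT /=.
  by case=> // y; rewrite !inE negb_or => /andP[h1 h2] _; exists y.
have bC : b \notin coatoms r.
  rewrite coE /covered_by bt bP /=; apply/forallPn; exists y.
  by rewrite bP tP (negPf yb) (negPf ybt).
have tA : t \notin atoms r.
  rewrite atE /covered_by bt bP /=; apply/forallPn; exists y.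
  by rewrite bP tP (negPf yb) (negPf ybt).
have dis : [disjoint coatoms r & atoms r].
  rewrite disjoints_subset; apply/subsetP => x xC.
  have xb : x != b by apply: contraNneq bC => <-.
  have xt : x != t by apply: contraNneq tC => <-.
  by rewrite inE atP // xC.
have -> : #|T| = #|(coatoms r :|: atoms r) :|: [set b; t]|.
  rewrite -cardsT; congr #|pred_of_set _|; apply/setP => x.
  rewrite in_setT in_setU in_setU in_set2.
  have [->|xb] := eqVneq x b; first by rewrite orbT.
  have [->|xt] := eqVneq x t; first by rewrite !orbT.
  by rewrite atP // orbF orbN.
rewrite cardsU cards2 bt.
have -> : (coatoms r :|: atoms r) :&: [set b; t] = set0.
  apply/setP => x; rewrite !in_setI in_setU in_set2 in_set0.
  have [->|xb] := eqVneq x b; first by rewrite (negPf bA) (negPf bC).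
  have [->|xt] := eqVneq x t; first by rewrite (negPf tA) (negPf tC).
  by rewrite andbF.
by rewrite cards0 subn0 cardsU disjoint_setI0 // cards0 subn0.
Qed.

(* Main.v *)
From Stdlib Require Import NArith.
Require Import Defs.
From mathcomp Require Import all_boot all_order all_algebra all_fingroup.

Set Implicit Arguments.
Unset Strict Implicit.
Unset Printing Implicit Defensive.

(** Label the coatoms by a set [P] with seven elements. A rank-3 lattice is then
    the same as a map [m] from subsets of [P] to naturals, [m B] being the number
    of atoms whose set of upper coatoms is [B]: any two coatoms have at most one
    common lower atom, every coatom lies above an atom and every atom below a
    coatom. Isomorphism classes are the orbits of the symmetric group of [P], so
    Burnside's lemma reduces the count to configurations fixed by a permutation
    [s]. Such a configuration consists of an [s]-invariant family [L] of blocks of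
    size at least two, pairwise meeting in at most one point, and of an
    [s]-invariant distribution of the other atoms on the points, with at least one
    on each point not covered by [L]. If [s] has cycle lengths [l_1, ..., l_k] and
    [w] is the number of blocks plus the number of uncovered points, the number of
    distributions is the number of solutions of [sum_j l_j * x_j = a - w], a
    polynomial in [a] of degree [k - 1] up to [O(a ^ 2)]. So only the seven
    conjugacy classes with at least four cycles matter, and from each of them only
    the moments of [w] of order at most [k - 4]; these are computed by recursion on
    the [s]-orbits of blocks. *)

(** * Rank-3 lattices as colorings *)

(** There are 35406319 linear families on seven points, too many to list one by one, so the moments
    must come from a recursion that shares work. The obstacle is the number of uncovered points,
    which is not additive over blocks. It is traded for sums over test sets [J] that the family must
    avoid; what remains is the number of blocks, which is additive over orbits. Two distinct pairs
    always meet in at most one point, so branching is confined to blocks of size at least three.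
    Binomial moments replace powers because Vandermonde's identity splits them. The order k - 4
    suffices because each factor [w] lowers by one the degree in [a] of a term that starts at degree
    k - 1, and only degrees at least 3 are kept. The orbit and cycle algorithms are not proved
    correct in general: boolean certificates such as [orbits_ok], [ids_ok] and [conjugacy_ok] are
    evaluated for the permutations that occur. *)

Definition color (P : finType) : finType := (bool + (P + {set P}))%type.
Notation Bot := (inl false).
Notation Top := (inl true).
Notation Coatom i := (inr (inl i)).
Notation Atom S := (inr (inr S)).

Definition color_le (P : finType) (k k' : color P) : bool :=
  match k, k' with
  | Bot, _ | _, Top => true
  | Atom B, Coatom i => i \in B
  | _, _ => false
  end.

Definition is_atom (P : finType) (k : color P) : bool :=
  if k is Atom _ then true else false.

(** Only atoms may share a color. Since [coloring_linear] includes the case of equal blocks, only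
    singleton blocks can repeat. The same field gives meets and joins: two distinct coatoms have at
    most one common lower atom, and two distinct atoms at most one common upper coatom. *)
Record coloring (P T : finType) (r : rel T) (kap : T -> color P) : Prop := {
  coloring_rel : forall x y, r x y = (x == y) || color_le (kap x) (kap y);
  coloring_inj : forall x y, kap x = kap y -> ~~ is_atom (kap x) -> x = y;
  coloring_surj : forall k, ~~ is_atom k -> exists x, kap x = k;
  coloring_atom : forall x, kap x <> Atom set0;
  coloring_linear : forall x x' S S' i j, kap x = Atom S -> kap x' = Atom S' ->
    i != j -> i \in S -> j \in S -> i \in S' -> j \in S' -> x = x';
  coloring_cover : forall i, exists x S, kap x = Atom S /\ i \in S }.

(** * From a coloring to a graded lattice of rank 3 *)

Section ColoringLattice.
Variables (P T : finType) (r : rel T) (kap : T -> color P).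
Hypothesis col : coloring r kap.
Variable i0 : P.

Let relE := coloring_rel col.

Lemma coloring_refl x : r x x.
Proof. by rewrite relE eqxx. Qed.

Lemma color_le_trans : transitive (@color_le P).
Proof. by move=> [[]|[i|S]] [[]|[j|S']] [[]|[k|S'']]. Qed.

Lemma coloring_trans : transitive r.
Proof.
move=> y x z; rewrite !relE => /orP[/eqP -> //|xy] /orP[/eqP <-|yz].
  by rewrite xy orbT.
by rewrite (color_le_trans xy yz) orbT.
Qed.

Lemma coloring_anti x y : r x y -> r y x -> x = y.
Proof.
rewrite !relE => /orP[/eqP //|xy] /orP[/eqP //|yx].
apply: (coloring_inj col).
  by move: xy yx; case: (kap x) => [[]|[i|S]]; case: (kap y) => [[]|[j|S']].
by move: xy yx; case: (kap x) => [[]|[i|S]]; case: (kap y) => [[]|[j|S']].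
Qed.

Lemma coloring_order : order_relation r.
Proof.
apply/and3P; split.
- by apply/forallP => x; apply: coloring_refl.
- apply/forallP => x; apply/forallP => y; apply/implyP => /andP[xy yx].
  by apply/eqP/coloring_anti.
apply/forallP => x; apply/forallP => y; apply/forallP => z.
by apply/implyP => /andP[xy yz]; apply: coloring_trans xy yz.
Qed.

Lemma coloring_bottom b : kap b = Bot -> forall x, r b x.
Proof. by move=> e x; rewrite relE e orbT. Qed.

Lemma coloring_top t : kap t = Top -> forall x, r x t.
Proof.
by move=> e x; rewrite relE e; case: (kap x) => [[]|[i|S]]; rewrite orbT.
Qed.

Lemma coloring_lower x y z : ~~ r x y -> ~~ r y x -> kap z <> Bot ->
  r z x -> r z y -> exists S i j,
  [/\ kap z = Atom S, kap x = Coatom i, kap y = Coatom j, i \in S & j \in S].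
Proof.
move=> nxy nyx zb zx zy.
have zx' : z != x by apply: contraNneq nxy => <-.
have zy' : z != y by apply: contraNneq nyx => <-.
move: zx zy zb; rewrite !relE (negPf zx') (negPf zy') /=.
move: nxy nyx; rewrite !relE !negb_or => /andP[_ nxy] /andP[_ nyx].
move: nxy nyx; case: (kap z) => [[]|[k|S]];
  case: (kap x) => [[]|[i|S1]]; case: (kap y) => [[]|[j|S2]] //=.
by exists S, i, j.
Qed.

Lemma coloring_upper x y z : ~~ r x y -> ~~ r y x -> kap z <> Top ->
  r x z -> r y z -> exists S S' i,
  [/\ kap z = Coatom i, kap x = Atom S, kap y = Atom S', i \in S & i \in S'].
Proof.
move=> nxy nyx zb zx zy.
have zx' : x != z by apply: contraNneq nyx => ->.
have zy' : y != z by apply: contraNneq nxy => ->.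
move: zx zy zb; rewrite !relE (negPf zx') (negPf zy') /=.
move: nxy nyx; rewrite !relE !negb_or => /andP[_ nxy] /andP[_ nyx].
move: nxy nyx; case: (kap z) => [[]|[i|S]];
  case: (kap x) => [[]|[j|S1]]; case: (kap y) => [[]|[k|S2]] //=.
by exists S1, S2, i.
Qed.

(** Among incomparable pairs, only two coatoms can have a common lower bound other than the bottom,
    and it is then the unique atom below both. *)
Lemma coloring_glb x y : exists m, is_glb r x y m.
Proof.
have [b eb] := coloring_surj col (k := Bot) isT.
have rb := coloring_bottom eb.
have [xy|nxy] := boolP (r x y).
  exists x; rewrite /is_glb coloring_refl xy /=.
  by apply/forallP => z; apply/implyP => /andP[].
have [yx|nyx] := boolP (r y x).
  exists y; rewrite /is_glb coloring_refl yx /=.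
  by apply/forallP => z; apply/implyP => /andP[].
have [/existsP[z /and3P[zb zx zy]]|/existsPn no] :=
  boolP [exists z, [&& kap z != Bot, r z x & r z y]].
  exists z; rewrite /is_glb zx zy /=; apply/forallP => z'.
  apply/implyP => /andP[z'x z'y].
  have [e|/eqP z'b] := eqVneq (kap z') Bot.
    exact: coloring_bottom.
  have [S [i [j [eS ei ej iS jS]]]] := coloring_lower nxy nyx (elimN eqP zb) zx zy.
  have [S' [i' [j' [eS' ei' ej' iS' jS']]]] := coloring_lower nxy nyx z'b z'x z'y.
  move: ei' ej'; rewrite ei ej => -[?] [?]; subst i' j'.
  have ij : i != j.
    apply/eqP => ij; move: nxy; rewrite (coloring_inj col (x := x) (y := y)).
    - by rewrite coloring_refl.
    - by rewrite ei ej ij.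
    - by rewrite ei.
  by rewrite (coloring_linear col eS' eS ij iS' jS' iS jS) coloring_refl.
exists b; rewrite /is_glb !rb /=; apply/forallP => z; apply/implyP => /andP[zx zy].
move: (no z); rewrite zx zy !andbT negbK => /eqP ez.
by rewrite (coloring_inj col (x := z) (y := b)) ?coloring_refl // ez.
Qed.

Lemma coloring_lub x y : exists m, is_lub r x y m.
Proof.
have [t et] := coloring_surj col (k := Top) isT.
have rt := coloring_top et.
have [xy|nxy] := boolP (r x y).
  exists y; rewrite /is_lub coloring_refl xy /=.
  by apply/forallP => z; apply/implyP => /andP[].
have [yx|nyx] := boolP (r y x).
  exists x; rewrite /is_lub coloring_refl yx /=.
  by apply/forallP => z; apply/implyP => /andP[].
have [/existsP[z /and3P[zb zx zy]]|/existsPn no] :=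
  boolP [exists z, [&& kap z != Top, r x z & r y z]].
  exists z; rewrite /is_lub zx zy /=; apply/forallP => z'.
  apply/implyP => /andP[z'x z'y].
  have [e|/eqP z'b] := eqVneq (kap z') Top.
    exact: coloring_top.
  have [S [S1 [i [ei eS eS1 iS iS1]]]] := coloring_upper nxy nyx (elimN eqP zb) zx zy.
  have [S' [S1' [j [ej eS' eS1' jS jS1]]]] := coloring_upper nxy nyx z'b z'x z'y.
  move: eS' eS1'; rewrite eS eS1 => -[?] [?]; subst S' S1'.
  have [ij|ij] := eqVneq i j.
    have -> : z = z' by apply: (coloring_inj col); rewrite ei // ej ij.
    exact: coloring_refl.
  move: nxy; rewrite (coloring_linear col eS eS1 ij iS jS iS1 jS1).
  by rewrite coloring_refl.
exists t; rewrite /is_lub !rt /=; apply/forallP => z; apply/implyP => /andP[zx zy].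
move: (no z); rewrite zx zy !andbT negbK => /eqP ez.
exact: coloring_top.
Qed.

(** A maximal chain contains every element comparable with all its members. Hence it contains the
    bottom and the top, and also an atom and a coatom, since a missing one could be added; two
    distinct elements of the same middle level are never comparable. *)
Lemma coloring_graded : graded_rank3 r.
Proof.
have [b eb] := coloring_surj col (k := Bot) isT.
have [t et] := coloring_surj col (k := Top) isT.
apply/forallP => D; apply/implyP => /maxsetP[/forall_inP chD maxD].
have addD z : (forall x, x \in D -> r x z || r z x) -> z \in D.
  move=> zD; rewrite -(maxD (z |: D)) ?setU11 ?subsetUr //.
  apply/forall_inP => x /setU1P[->|xD]; apply/forall_inP => y /setU1P[->|yD].
  - by rewrite coloring_refl.
  - by rewrite orbC zD.
  - exact: zD.
  - exact: (forall_inP (chD x xD)).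
have bD : b \in D by apply: addD => x _; rewrite (coloring_bottom eb) orbT.
have tD : t \in D by apply: addD => x _; rewrite (coloring_top et).
have cmp x y : x \in D -> y \in D -> r x y || r y x.
  by move=> xD; exact: (forall_inP (chD x xD)).
have coD x y i j : x \in D -> y \in D -> kap x = Coatom i -> kap y = Coatom j -> x = y.
  move=> xD yD ex ey; have := cmp x y xD yD; rewrite !relE ex ey /= !orbF.
  by case/orP => /eqP.
have atD x y S S' : x \in D -> y \in D -> kap x = Atom S -> kap y = Atom S' -> x = y.
  move=> xD yD ex ey; have := cmp x y xD yD; rewrite !relE ex ey /= !orbF.
  by case/orP => /eqP.
(* Without an atom the chain could be enlarged: by an atom below its coatom if it has one, otherwise
   by an atom below [i0]. *)
have [x xD [S eS]] : exists2 x, x \in D & exists S, kap x = Atom S.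
  have [/existsP[y /andP[yD yco]]|/existsPn noco] :=
    boolP [exists y, (y \in D) && (if kap y is Coatom _ then true else false)].
    case ey : (kap y) yco => [[]|[i|S]] // _.
    have [x [S [ex iS]]] := coloring_cover col i.
    have [|/existsPn noat] := boolP [exists x, (x \in D) && is_atom (kap x)].
      case/existsP => x' /andP[x'D]; case ex' : (kap x') => [[]|[j|S']] // _.
      by exists x' => //; exists S'.
    exists x; last by exists S.
    apply: addD => z zD; move: (noat z); rewrite zD /= !relE.
    case ez : (kap z) => [[]|[j|S']] //= _; rewrite ?orbT // ?ex ?orbT //=.
    by have := coD z y j i zD yD ez ey => zy; move: ez; rewrite zy ey => -[<-]; rewrite iS !orbT.
  have [x [S [ex iS]]] := coloring_cover col i0.
  have [|/existsPn noat] := boolP [exists x, (x \in D) && is_atom (kap x)].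
    case/existsP => x' /andP[x'D]; case ex' : (kap x') => [[]|[j|S']] // _.
    by exists x' => //; exists S'.
  exists x; last by exists S.
  apply: addD => z zD; move: (noat z) (noco z); rewrite zD /= !relE.
  by case ez : (kap z) => [[]|[j|S']] //= _; rewrite ?orbT // ?ex ?orbT.
have [i iS] : exists i, i \in S.
  by apply/set0Pn/eqP => S0; apply: (@coloring_atom _ _ _ _ col x); rewrite eS S0.
have [y yD [j ey]] : exists2 y, y \in D & exists j, kap y = Coatom j.
  have [|/existsPn noco] :=
    boolP [exists y, (y \in D) && (if kap y is Coatom _ then true else false)].
    case/existsP => y /andP[yD]; case ey : (kap y) => [[]|[j|S']] // _.
    by exists y => //; exists j.
  have [y ey] := coloring_surj col (k := Coatom i) isT.
  exists y; last by exists i.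
  apply: addD => z zD; move: (noco z); rewrite zD /= !relE ey.
  case ez : (kap z) => [[]|[j|S']] //= _; rewrite ?orbT //.
  by have zx := atD z x S' S zD xD ez eS; move: ez; rewrite zx eS => -[<-]; rewrite iS orbT.
have -> : D = [set b; x; y; t].
  apply/setP => z; rewrite !inE; apply/idP/idP => [zD|]; last first.
    by case/orP => [/orP[/orP[]|]|] /eqP ->.
  case ez : (kap z) => [[]|[k|S']].
  - by rewrite (coloring_inj col (x := z) (y := t)) ?eqxx ?orbT ?ez ?et.
  - by rewrite (coloring_inj col (x := z) (y := b)) ?eqxx ?orbT ?ez ?eb.
  - by rewrite (coD z y _ _ zD yD ez ey) eqxx !orbT.
  - by rewrite (atD z x _ _ zD xD ez eS) eqxx !orbT.
have neq u v : kap u <> kap v -> u != v by move=> h; apply/eqP => e; rewrite e in h.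
rewrite -!setUA !cardsU1 !inE !negb_or cards1.
by rewrite !neq // ?eb ?et ?eS ?ey.
Qed.

Lemma coloring_lattice : lattice_relation r.
Proof.
rewrite /lattice_relation coloring_order /=.
apply/forallP => x; apply/forallP => y; apply/andP; split; apply/existsP.
  exact: coloring_glb.
exact: coloring_lub.
Qed.

Lemma coloring_is_bottom x : is_bottom r x = (kap x == Bot).
Proof.
apply/forallP/eqP => [h|e y]; last exact: coloring_bottom.
have [b eb] := coloring_surj col (k := Bot) isT.
by rewrite (coloring_anti (h b) (coloring_bottom eb x)).
Qed.

Lemma coloring_is_top x : is_top r x = (kap x == Top).
Proof.
apply/forallP/eqP => [h|e y]; last exact: coloring_top.
have [t et] := coloring_surj col (k := Top) isT.
by rewrite (coloring_anti (coloring_top et x) (h t)).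
Qed.

Lemma coloring_atoms : atoms r = [set x | is_atom (kap x)].
Proof.
have [b eb] := coloring_surj col (k := Bot) isT.
apply/setP => x; rewrite !inE; apply/existsP/idP => [[b' /andP[]]|xA].
  rewrite coloring_is_bottom => /eqP eb' /and3P[bx _ /forallP cov].
  have low y : r y x -> y = b' \/ y = x.
    by move=> yx; have := cov y; rewrite yx coloring_bottom // => /orP[]/eqP; auto.
  have [y [S [ey iS]]] := coloring_cover col i0.
  case ex : (kap x) => [[]|[i|S']] //.
  - have /low[e|e] : r y x by rewrite relE ex ey orbT.
      by move: ey; rewrite e eb'.
    by move: ey; rewrite e ex.
  - by case/eqP: bx; apply: (coloring_inj col); rewrite ?ex ?eb'.
  - have [z [S' [ez iS']]] := coloring_cover col i.
    have /low[e|e] : r z x by rewrite relE ex ez /= iS' orbT.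
      by move: ez; rewrite e eb'.
    by move: ez; rewrite e ex.
exists b; rewrite coloring_is_bottom eb eqxx /=; apply/and3P; split.
- by apply: contraTneq xA => <-; rewrite eb.
- exact: coloring_bottom.
apply/forallP => z; apply/implyP => /andP[_]; rewrite relE => /orP[->|]; first by rewrite orbT.
case: (kap x) xA => [[]|[i|S]] //= _; case ez : (kap z) => [[]|[i|S']] //= _.
by rewrite (coloring_inj col (x := z) (y := b)) ?eqxx ?ez ?eb.
Qed.

Definition is_coatom (k : color P) : bool := if k is Coatom _ then true else false.

Lemma coloring_coatoms : coatoms r = [set x | is_coatom (kap x)].
Proof.
have [t et] := coloring_surj col (k := Top) isT.
apply/setP => x; rewrite !inE; apply/existsP/idP => [[b' /andP[]]|xA].
  rewrite coloring_is_top => /eqP eb' /and3P[bx _ /forallP cov].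
  have low y : r x y -> y = x \/ y = b'.
    by move=> yx; have := cov y; rewrite yx coloring_top // => /orP[]/eqP; auto.
  have [y ey] := coloring_surj col (k := Coatom i0) isT.
  case ex : (kap x) => [[]|[i|S']] //.
  - by case/eqP: bx; apply: (coloring_inj col); rewrite ?ex ?eb'.
  - have /low[e|e] : r x y by rewrite relE ex orbT.
      by move: ey; rewrite e ex.
    by move: ey; rewrite e eb'.
  - have [i iS] : exists i, i \in S'.
      by apply/set0Pn/eqP => S0; apply: (@coloring_atom _ _ _ _ col x); rewrite ex S0.
    have [z ez] := coloring_surj col (k := Coatom i) isT.
    have /low[e|e] : r x z by rewrite relE ex ez /= iS orbT.
      by move: ez; rewrite e ex.
    by move: ez; rewrite e eb'.
exists t; rewrite coloring_is_top et eqxx /=; apply/and3P; split.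
- by apply: contraTneq xA => ->; rewrite et.
- exact: coloring_top.
apply/forallP => z; apply/implyP => /andP[]; rewrite relE => /orP[/eqP ->|]; first by rewrite eqxx.
case: (kap x) xA => [[]|[i|S]] //= _; case ez : (kap z) => [[]|[j|S']] //= _.
by rewrite (coloring_inj col (x := z) (y := t)) ?eqxx ?orbT ?ez ?et.
Qed.

Lemma coloring_card_coatoms : #|coatoms r| = #|P|.
Proof.
rewrite coloring_coatoms.
have <- : #|kap @: [set x | is_coatom (kap x)]| = #|[set x | is_coatom (kap x)]|.
  apply: card_in_imset => x y; rewrite !inE => xc _ e.
  by apply: (coloring_inj col) e _; case: (kap x) xc => [[]|[]].
have -> : kap @: [set x | is_coatom (kap x)] = [set Coatom i | i in [set: P]].
  apply/setP => k; apply/imsetP/imsetP => [[x]|[i _ ->]].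
    by rewrite inE; case ex : (kap x) => [[]|[i|S]] // _ ->; exists i.
  have [x ex] := coloring_surj col (k := Coatom i) isT.
  by exists x; rewrite ?inE ex.
by rewrite card_imset ?cardsT // => i j [].
Qed.

Lemma coloring_rank3 a : #|[set x | is_atom (kap x)]| = a -> rank3_lattice #|P| a r.
Proof.
move=> ea; rewrite /rank3_lattice coloring_lattice coloring_graded.
by rewrite coloring_card_coatoms coloring_atoms ea !eqxx.
Qed.

End ColoringLattice.

(** * From a graded lattice of rank 3 to a coloring *)

Section Rank3Coloring.
Variables (P T : finType) (r : rel T) (a : nat).
Hypothesis lat : rank3_lattice #|P| a r.

Let graded : graded_rank3 r. Proof. by case/and4P: lat. Qed.
Let lattice : lattice_relation r. Proof. by case/and4P: lat. Qed.

Lemma rank3_refl x : r x x.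
Proof. by case/andP: lattice => /and3P[/forallP]. Qed.

Lemma rank3_anti x y : r x y -> r y x -> x = y.
Proof.
case/andP: lattice => /and3P[_ /forallP ra _] _ xy yx.
by move/forallP: (ra x) => /(_ y); rewrite xy yx => /eqP.
Qed.

Lemma rank3_trans x y z : r x y -> r y z -> r x z.
Proof.
case/andP: lattice => /and3P[_ _ /forallP rt] _ xy yz.
by move/forallP: (rt x) => /(_ y) /forallP /(_ z); rewrite xy yz.
Qed.

Lemma rank3_glb x y : exists m,
  [/\ r m x, r m y & forall z, r z x -> r z y -> r z m].
Proof.
case/andP: lattice => _ /forallP /(_ x) /forallP /(_ y) /andP[h _].
case/existsP: h => m /and3P[mx my /forallP h]; exists m; split=> // z zx zy.
by move: (h z); rewrite zx zy.
Qed.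

Lemma rank3_bounds : exists b t, [/\ forall x, r b x, forall x, r x t & b <> t].
Proof.
have [x0 _ _] := chain_extend (s := [::]) graded isT isT isT.
have [b /forallP bP] := bottom_exists lattice x0.
have [t /forallP tP] := top_exists lattice x0.
exists b, t; split=> // e.
have := chain_extend (s := [:: b]) graded isT isT.
rewrite /= rank3_refl => /(_ isT)[y]; rewrite inE => /eqP; case.
by apply: rank3_anti; rewrite ?bP // e tP.
Qed.

Variables b t : T.
Hypotheses (bP : forall x, r b x) (tP : forall x, r x t) (bt : b <> t).

Let strict (x y : T) := (x != y) && r x y.

Lemma rank3_strict_trans x y z : strict x y -> strict y z -> strict x z.
Proof.
move=> /andP[xy rxy] /andP[yz ryz]; rewrite /strict (rank3_trans rxy ryz) andbT.
by apply: contraNneq xy => e; apply/eqP/rank3_anti; rewrite // e.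
Qed.

Lemma rank3_no_long_chain x y z :
  strict b x -> strict x y -> strict y z -> ~~ strict z t.
Proof.
move=> bx xy yz; apply/negP => zt.
have by' := rank3_strict_trans bx xy; have bz := rank3_strict_trans by' yz.
have bt' := rank3_strict_trans bz zt; have xz := rank3_strict_trans xy yz.
have xt := rank3_strict_trans xz zt; have yt := rank3_strict_trans yz zt.
have := chain_le4 (s := [:: b; x; y; z; t]) graded.
move: bx xy yz zt by' bz bt' xz xt yt; rewrite /= !inE !negb_or !rank3_refl.
(* The ten strict relations supply both the ten inequalities behind [uniq] and the ten
   comparabilities of the chain. *)
do 10! (case/andP => -> ->); rewrite !orbT.
by move/(_ isT isT).
Qed.

(** The chain b < x < t has three elements, so it is not maximal; any element that extends it will
    do. *)
Lemma rank3_comparable x : x != b -> x != t ->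
  exists y, [&& y != b, y != t & strict x y || strict y x].
Proof.
move=> xb xt; have := chain_extend (s := [:: b; x; t]) graded.
rewrite /= !inE !bP !tP !rank3_refl eq_sym (negPf xb) (introF eqP bt) (negPf xt).
rewrite !orbT /=; case=> // y; rewrite !inE !negb_or => /and3P[h1 h2 h3] /and4P[_ h _ _].
by exists y; rewrite h1 h3 /strict h2 (eq_sym x) h2.
Qed.

Lemma rank3_atomsE x : (x \in atoms r) = covered_by r b x.
Proof.
rewrite inE; apply/existsP/idP => [[b' /andP[/forallP h]]|h].
  by rewrite (rank3_anti (bP b') (h b)).
by exists b; rewrite h andbT; apply/forallP.
Qed.

Lemma rank3_coatomsE x : (x \in coatoms r) = covered_by r x t.
Proof.
rewrite inE; apply/existsP/idP => [[t' /andP[/forallP h]]|h].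
  by rewrite (rank3_anti (tP t') (h t)).
by exists t; rewrite h andbT; apply/forallP.
Qed.

(** An element strictly between the bottom and [x], or between [y] and the top, would complete a
    chain of five elements. Conversely [y] separates [x] from the top, and [x] separates the bottom
    from [y]. *)
Lemma rank3_below x y : x != b -> y != t -> strict x y ->
  [/\ x \in atoms r, y \in coatoms r, x \notin coatoms r & y \notin atoms r].
Proof.
move=> xb yt xy; have bx : strict b x by rewrite /strict eq_sym xb bP.
have yt' : strict y t by rewrite /strict yt tP.
have /andP[xneqt _] := rank3_strict_trans xy yt'.
have /andP[bneqy _] := rank3_strict_trans bx xy.
case/andP: (xy) => nxy rxy.
rewrite !rank3_atomsE !rank3_coatomsE /covered_by !bP !tP yt bneqy xneqt /=.
rewrite eq_sym xb /=; split.
- apply/forallP => z; apply/implyP => /andP[_ zx]; apply/norP => -[zb zneqx].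
  have zx' : strict z x by rewrite /strict zneqx.
  have bz : strict b z by rewrite /strict eq_sym zb bP.
  by move: (rank3_no_long_chain bz zx' xy); rewrite yt'.
- apply/forallP => z; apply/implyP => /andP[yz _]; apply/norP => -[zy zt].
  have yz' : strict y z by rewrite /strict eq_sym zy.
  have zt' : strict z t by rewrite /strict zt tP.
  by move: (rank3_no_long_chain bx xy yz'); rewrite zt'.
- apply/forallPn; exists y.
  by rewrite rxy tP (negPf yt) orbF eq_sym (negPf nxy).
apply/forallPn; exists x.
by rewrite rxy bP (negPf nxy) (negPf xb).
Qed.

Lemma rank3_atom_xor_coatom x : x != b -> x != t ->
  (x \in atoms r) = (x \notin coatoms r).
Proof.
move=> xb xt; have [y /and3P[yb yt /orP[xy|yx]]] := rank3_comparable xb xt.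
  by have [-> _ -> _] := rank3_below xb yt xy.
by have [_ -> _ /negPf ->] := rank3_below yb xt yx.
Qed.

Lemma rank3_bounds_not : [/\ b \notin atoms r, b \notin coatoms r,
  t \notin atoms r & t \notin coatoms r].
Proof.
have : exists y, y != b /\ y != t.
  have := chain_extend (s := [:: b; t]) graded.
  rewrite /= !inE !bP !tP (introF eqP bt) !orbT /=.
  by case=> // y; rewrite !inE negb_or => /andP[h1 h2] _; exists y.
case=> y [yb yt]; rewrite !rank3_atomsE !rank3_coatomsE /covered_by !eqxx /=.
rewrite !bP (introF eqP bt) /=; split=> //; last first.
all: by apply/forallPn; exists y; rewrite bP tP (negPf yb) (negPf yt).
Qed.

Lemma rank3_coatom_above x : x \in atoms r -> exists2 y, y \in coatoms r & r x y.
Proof.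
have [bA _ tA _] := rank3_bounds_not.
move=> xA; have xb : x != b by apply: contraNneq bA => <-.
have xt : x != t by apply: contraNneq tA => <-.
have [y /and3P[yb yt /orP[xy|yx]]] := rank3_comparable xb xt.
  by exists y; [case: (rank3_below xb yt xy) | case/andP: xy].
by have [_ _ _] := rank3_below yb xt yx; rewrite xA.
Qed.

Lemma rank3_atom_below y : y \in coatoms r -> exists2 x, x \in atoms r & r x y.
Proof.
have [_ bC _ tC] := rank3_bounds_not.
move=> xA; have xb : y != b by apply: contraNneq bC => <-.
have xt : y != t by apply: contraNneq tC => <-.
have [x /and3P[yb yt /orP[xy|yx]]] := rank3_comparable xb xt.
  by have [_ _ ] := rank3_below xb yt xy; rewrite xA.
by exists x; [case: (rank3_below yb xt yx) | case/andP: yx].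
Qed.

Lemma rank3_middle x y : x != b -> y != t -> x != y -> r x y ->
  x \in atoms r /\ y \in coatoms r.
Proof. by move=> xb yt xy rxy; case: (@rank3_below x y); rewrite // /strict xy. Qed.

(** Both atoms lie below the meet [m] of the two coatoms. An atom strictly below [m] would make [m]
    a coatom, whereas [m] is an atom because it lies strictly below [y]. *)
Lemma rank3_linear x x' y y' : x \in atoms r -> x' \in atoms r ->
  y \in coatoms r -> y' \in coatoms r -> y != y' ->
  r x y -> r x y' -> r x' y -> r x' y' -> x = x'.
Proof.
have [bA bC tA tC] := rank3_bounds_not.
move=> xA x'A yC y'C yy' xy xy' x'y x'y'.
have [m [my my' mP]] := rank3_glb y y'.
suff glbE z : z \in atoms r -> r z y -> r z y' -> z = m.
  by rewrite (glbE x xA xy xy') (glbE x' x'A x'y x'y').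
move=> zA zy zy'; apply/eqP/negP => /negP zm.
have zb : z != b by apply: contraNneq bA => <-.
have yt : y != t by apply: contraNneq tC => <-.
have y't : y' != t by apply: contraNneq tC => <-.
have zm' := mP z zy zy'.
have ym : m != y.
  apply: contraNneq yy' => e; apply/eqP; move: my'; rewrite e => ryy'.
  apply/eqP/negP => /negP nyy'.
  have yb : y != b by apply: contraNneq bC => <-.
  have [yA _] := rank3_middle yb y't nyy' ryy'.
  by move: (rank3_atom_xor_coatom yb yt); rewrite yA yC.
have mt : m != t by apply: contraNneq yt => e; apply/eqP/rank3_anti; rewrite // -e.
have [_ mC] := rank3_middle zb mt zm zm'.
have mb : m != b by apply: contraNneq bC => <-.
have [mA _] := rank3_middle mb yt ym my.
by move: (rank3_atom_xor_coatom mb mt); rewrite mA mC.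
Qed.

Lemma rank3_has_coloring : exists kap : T -> color P, coloring r kap.
Proof.
have [bA bC tA tC] := rank3_bounds_not.
have e : #|P| = #|coatoms r| by case/and4P: lat => _ _ /eqP.
pose g (i : P) := enum_val (cast_ord e (enum_rank i)).
have gC i : g i \in coatoms r by apply: enum_valP.
have g_inj : injective g.
  by move=> i j /enum_val_inj /cast_ord_inj /enum_rank_inj.
have g_surj x : x \in coatoms r -> exists i, g i = x.
  move=> xC; exists (enum_val (cast_ord (esym e) (enum_rank_in xC x))).
  by rewrite /g enum_valK cast_ordKV enum_rankK_in.
have [gb gt] : (forall i, g i != b) /\ (forall i, g i != t).
  by split=> i; [apply: contraNneq bC => <-|apply: contraNneq tC => <-].
pose kap x : color P := if x == b then Bot else if x == t then Top else
  if [pick i | g i == x] is Some i then Coatom i else Atom [set i | r x (g i)].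
have kb : kap b = Bot by rewrite /kap eqxx.
have kt : kap t = Top by rewrite /kap eqxx eq_sym (introF eqP bt).
have kg i : kap (g i) = Coatom i.
  rewrite /kap (negPf (gb i)) (negPf (gt i)).
  by case: pickP => [j /eqP/g_inj -> //|/(_ i)]; rewrite eqxx.
have kA x : x \in atoms r -> kap x = Atom [set i | r x (g i)].
  move=> xA; have xb : x != b by apply: contraNneq bA => <-.
  have xt : x != t by apply: contraNneq tA => <-.
  rewrite /kap (negPf xb) (negPf xt); case: pickP => // i /eqP gi.
  by move: (rank3_atom_xor_coatom xb xt); rewrite xA -gi gC.
have cases x : [\/ x = b, x = t, exists i, x = g i | x \in atoms r].
  have [->|xb] := eqVneq x b; first by constructor 1.
  have [->|xt] := eqVneq x t; first by constructor 2.
  have := rank3_atom_xor_coatom xb xt.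
  have [/g_surj[i <-] _|_ xA] := boolP (x \in coatoms r).
    by constructor 3; exists i.
  by constructor 4.
have kAtom x B : kap x = Atom B -> x \in atoms r /\ B = [set i | r x (g i)].
  case: (cases x) => [->|->|[i ->]|xA]; rewrite ?kb ?kt ?kg // kA //.
  by case=> <-.
exists kap; split.
- move=> x y; have [->|xy] := eqVneq x y; first by rewrite rank3_refl.
  have [->|xb] := eqVneq x b; first by rewrite kb bP.
  have [->|yt] := eqVneq y t.
    by rewrite kt tP; case: (kap x) => [[]|[]].
  apply/idP/idP => [rxy|].
    have [xA yC] := rank3_middle xb yt xy rxy.
    by have [j ej] := g_surj y yC; rewrite kA // -ej kg /= inE ej.
  case: (cases x) => [xe|->|[i ->]|xA]; first by rewrite xe eqxx in xb.
  + rewrite kt; case: (cases y) => [->|ye|[j ->]|yA]; rewrite ?kb ?kg ?kA //.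
    by rewrite ye eqxx in yt.
  + rewrite kg; case: (cases y) => [->|ye|[j ->]|yA]; rewrite ?kb ?kg ?kA //.
    by rewrite ye eqxx in yt.
  rewrite kA //; case: (cases y) => [->|ye|[j ->]|yA]; rewrite ?kb ?kg ?kA //=.
    by rewrite ye eqxx in yt.
  by rewrite inE.
- move=> x y; case: (cases x) => [->|->|[i ->]|xA];
    case: (cases y) => [->|->|[j ->]|yA]; rewrite ?kb ?kt ?kg ?(kA x) ?(kA y) //.
  by case=> ->.
- case=> [[]|[i|B]] // _; [by exists t|by exists b|by exists (g i)].
- move=> x /kAtom[xA B0]; have [y yC xy] := rank3_coatom_above xA.
  have [i ei] := g_surj y yC.
  by have := in_set0 i; rewrite B0 inE ei xy.
- move=> x x' B B' i j /kAtom[xA ->] /kAtom[x'A ->] ij; rewrite !inE => h1 h2 h3 h4.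
  apply: (rank3_linear xA x'A (gC i) (gC j)) => //.
  by apply: contraNneq ij => /g_inj ->.
move=> i; have [x xA xi] := rank3_atom_below (gC i).
by exists x, [set i | r x (g i)]; rewrite kA // inE.
Qed.

End Rank3Coloring.

Lemma rank3_coloring (P T : finType) (r : rel T) a :
  rank3_lattice #|P| a r -> exists kap : T -> color P, coloring r kap.
Proof.
move=> lat; have [b [t [bP tP bt]]] := rank3_bounds lat.
exact: rank3_has_coloring lat b t bP tP bt.
Qed.

(** * Isomorphism classes as orbits of configurations *)

(* [m B] is the number of atoms lying below exactly the coatoms labelled by [B]. *)
Definition configs (P : finType) (a : nat) : {set {ffun {set P} -> 'I_a.+1}} :=
  [set m : {ffun {set P} -> 'I_a.+1} |
    [&& m set0 == 0 :> nat, \sum_S m S == a,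
        [forall i, forall j, (i != j) ==>
           (\sum_(S : {set P} | (i \in S) && (j \in S)) m S <= 1)] &
        [forall i, exists S : {set P}, (i \in S) && (0 < m S)]]].

Definition color_count (P : finType) (a : nat) (m : {ffun {set P} -> 'I_a.+1})
    (k : color P) : nat :=
  if k is Atom B then m B else 1.

Definition has_counts (P T : finType) a (kap : T -> color P)
    (m : {ffun {set P} -> 'I_a.+1}) : Prop :=
  forall k, #|[set x | kap x == k]| = color_count m k.

Lemma sum_card_atoms (P T : finType) (kap : T -> color P) (Q : pred {set P}) :
  \sum_(B | Q B) #|[set x | kap x == Atom B]| =
  #|[set x | if kap x is Atom B then Q B else false]|.
Proof.
pose block x := if kap x is Atom B then B else set0.
rewrite -sum1_card (partition_big block Q) /=; last first.
  by move=> x; rewrite inE /block; case: (kap x) => [|[]].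
apply: eq_bigr => B QB; rewrite -sum1_card; apply: eq_bigl => x.
rewrite !inE /block; case: (kap x) => [|[]] //= B'.
by apply/eqP/andP => [[->]|[_ /eqP -> //]]; rewrite eqxx.
Qed.

Lemma config_coloring (P T : finType) a (r : rel T) (kap : T -> color P) m :
  m \in configs P a -> has_counts kap m ->
  (forall x y, r x y = (x == y) || color_le (kap x) (kap y)) ->
  coloring r kap.
Proof.
rewrite inE => /and4P[/eqP m0 _ /forallP lin /forallP cov] cnt rE; split=> //.
- move=> x y e nat; have : #|[set z | kap z == kap x]| = 1.
    by rewrite cnt; case: (kap x) nat => [|[]].
  move/eqP/cards1P => [z /setP h].
  have := h x; have := h y; rewrite !inE e eqxx => /esym/eqP -> /esym/eqP ->.
  by [].
- move=> k nat; have : 0 < #|[set z | kap z == k]|.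
    by rewrite cnt; case: k nat => [|[]].
  by case/card_gt0P => x; rewrite inE => /eqP; exists x.
- move=> x ex; have : 0 < #|[set z | kap z == Atom set0]|.
    by apply/card_gt0P; exists x; rewrite inE ex.
  by rewrite cnt /= m0.
- move=> x x' B B' i j ex ex' ij iB jB iB' jB'.
  have := lin i => /forallP/(_ j); rewrite ij /=.
  rewrite (eq_bigr (fun B => #|[set x | kap x == Atom B]|)); last first.
    by move=> C _; rewrite cnt.
  rewrite sum_card_atoms => /card_le1_eqP; apply.
    by rewrite inE ex' iB'.
  by rewrite inE ex iB.
move=> i; have /existsP[B /andP[iB]] := cov i.
rewrite -[val (m B)]/(color_count m (Atom B)) -cnt.
by case/card_gt0P => x; rewrite inE => /eqP ex; exists x, B.
Qed.

Lemma coloring_config (P T : finType) a (r : rel T) (kap : T -> color P) :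
  coloring r kap -> #|[set x | is_atom (kap x)]| = a ->
  exists2 m, m \in configs P a & has_counts kap m.
Proof.
move=> col ea.
have le B : #|[set x | kap x == Atom B]| < a.+1.
  rewrite ltnS -ea; apply/subset_leq_card/subsetP => x.
  by rewrite !inE => /eqP ->.
pose m : {ffun {set P} -> 'I_a.+1} := [ffun B => Ordinal (le B)].
have cnt : has_counts kap m.
  move=> k; have [|na] := boolP (is_atom k).
    by case: k => [|[]] //= B _; rewrite ffunE.
  have -> : color_count m k = 1 by case: k na => [|[]].
  have [x ex] := coloring_surj col na.
  apply/eqP/cards1P; exists x; apply/setP => y; rewrite !inE.
  by apply/eqP/eqP => [e|->//]; apply: (coloring_inj col); rewrite e.
exists m => //; rewrite inE; apply/and4P; split.
- rewrite ffunE /= cards_eq0; apply/eqP/setP => x; rewrite !inE.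
  exact/negbTE/eqP/(coloring_atom col).
- rewrite (eq_bigr (fun B => #|[set x | kap x == Atom B]|)); last first.
    by move=> B _; rewrite ffunE.
  by rewrite (sum_card_atoms kap xpredT) ea.
- apply/forallP => i; apply/forallP => j; apply/implyP => ij.
  rewrite (eq_bigr (fun B => #|[set x | kap x == Atom B]|)); last first.
    by move=> B _; rewrite ffunE.
  rewrite sum_card_atoms; apply/card_le1_eqP => x y; rewrite !inE.
  case ex : (kap x) => [|[|B]] // /andP[iB jB].
  case ey : (kap y) => [|[|B']] // /andP[iB' jB'].
  exact: (coloring_linear col ey ex ij).
apply/forallP => i; have [x [B [ex iB]]] := coloring_cover col i.
apply/existsP; exists B; rewrite iB ffunE /=; apply/card_gt0P; exists x.
by rewrite inE ex.
Qed.

(** Blocks move forward: the multiplicity of a block becomes that of its image under [s]. Written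
    with preimages, this is a right action. *)
Definition config_act (P : finType) a (m : {ffun {set P} -> 'I_a.+1})
    (s : {perm P}) : {ffun {set P} -> 'I_a.+1} :=
  [ffun B : {set P} => m (s @^-1: B)].

Lemma config_act1 (P : finType) a : @config_act P a ^~ 1%g =1 id.
Proof.
move=> m; apply/ffunP => B; rewrite ffunE; congr (m _).
by apply/setP => x; rewrite inE perm1.
Qed.

Lemma config_actM (P : finType) a m (s t : {perm P}) :
  @config_act P a m (s * t)%g = config_act (config_act m s) t.
Proof.
apply/ffunP => B; rewrite !ffunE; congr (m _).
by apply/setP => x; rewrite !inE permM.
Qed.

Canonical config_action (P : finType) a :=
  TotalAction (@config_act1 P a) (@config_actM P a).

Lemma preim_preimV (P : finType) (s : {perm P}) (B : {set P}) :
  s @^-1: ((s^-1)%g @^-1: B) = B.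
Proof. by apply/setP => x; rewrite !inE permK. Qed.

Lemma preimset_perm_inj (P : finType) (s : {perm P}) :
  injective (fun B : {set P} => s @^-1: B).
Proof.
move=> B C /setP e; apply/setP => x; have := e ((s^-1)%g x).
by rewrite !inE permKV.
Qed.

Lemma config_act_in (P : finType) a m (s : {perm P}) :
  m \in configs P a -> config_act m s \in configs P a.
Proof.
rewrite !inE => /and4P[m0 ms /forallP lin /forallP cov].
have inj := @preimset_perm_inj P s.
apply/and4P; split.
- by rewrite ffunE preimset0.
- apply/eqP; rewrite -[RHS](eqP ms) [RHS](reindex_inj inj) /=.
  by apply: eq_bigr => B _; rewrite ffunE.
- apply/forallP => i; apply/forallP => j; apply/implyP => ij.
  have ij' : (s^-1)%g i != (s^-1)%g j by rewrite (inj_eq perm_inj).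
  have := lin ((s^-1)%g i) => /forallP/(_ ((s^-1)%g j)); rewrite ij' /=.
  rewrite (reindex_inj inj) /=; apply: leq_trans.
  apply: eq_leq; apply: eq_big => [B|B _]; first by rewrite !inE !permKV.
  by rewrite ffunE.
apply/forallP => i; have /existsP[B /andP[iB mB]] := cov ((s^-1)%g i).
apply/existsP; exists ((s^-1)%g @^-1: B).
by rewrite !inE iB ffunE preim_preimV.
Qed.

Lemma acts_configs (P : finType) a :
  [acts [set: {perm P}], on configs P a | config_action P a].
Proof.
apply/actsP => s _ m; apply/idP/idP => [h|]; last exact: config_act_in.
have := config_act_in (s^-1)%g h.
by rewrite -config_actM mulgV config_act1.
Qed.

(** The link between labeled lattices and configurations: a configuration determines the lattice up
    to isomorphism, and a lattice determines the configuration up to relabeling its coatoms. *)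
Definition describes (P T : finType) a (E : {set T * T})
    (m : {ffun {set P} -> 'I_a.+1}) : bool :=
  [exists kap : {ffun T -> color P},
    [forall x, forall y, rel_of E x y == (x == y) || color_le (kap x) (kap y)] &&
    [forall k, #|[set x | kap x == k]| == color_count m k]].

Lemma describesP (P T : finType) a (E : {set T * T}) (m : {ffun {set P} -> 'I_a.+1}) :
  reflect (exists kap : T -> color P,
    (forall x y, rel_of E x y = (x == y) || color_le (kap x) (kap y)) /\
    has_counts kap m) (describes E m).
Proof.
apply: (iffP existsP) => -[kap].
  case/andP => /forallP h1 /forallP h2; exists kap; split.
    by move=> x y; move/forallP: (h1 x) => /(_ y) /eqP.
  by move=> k; apply/eqP.
case=> h1 h2; exists (finfun kap); apply/andP; split.
  by apply/forallP => x; apply/forallP => y; rewrite !ffunE h1.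
apply/forallP => k; rewrite -h2; apply/eqP/eq_card => x.
by rewrite !inE ffunE.
Qed.

Lemma same_counts_perm (K : finType) n (f g : 'I_n -> K) :
  (forall k, #|[set x | f x == k]| = #|[set x | g x == k]|) ->
  exists p : 'S_n, forall x, f x = g (p x).
Proof.
move=> h; have cntE (u : 'I_n -> K) k :
    count_mem k [tuple u i | i < n] = #|[set x | u x == k]|.
  by rewrite /= count_map -sum1_count -sum1dep_card big_enum_cond.
have /tuple_permP[p e] : perm_eq [tuple f i | i < n] [tuple g i | i < n].
  by apply/allP => k _; rewrite /= !cntE h.
exists p => x; have /(congr1 (fun t => tnth t x)) := val_inj e.
by rewrite !tnth_mktuple.
Qed.

Lemma describes_isomorphic (P : finType) n a (E F : {set 'I_n * 'I_n})
    (m : {ffun {set P} -> 'I_a.+1}) :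
  describes E m -> describes F m -> isomorphic E F.
Proof.
case/describesP => kap [kE kc] /describesP[kap' [kE' kc']].
have [|p pP] := @same_counts_perm _ _ kap kap'.
  by move=> k; rewrite kc kc'.
apply/existsP; exists p; apply/forallP => x; apply/forallP => y.
by rewrite kE kE' !pP (inj_eq perm_inj).
Qed.

Lemma isomorphic_describes (P T : finType) a (E F : {set T * T})
    (m : {ffun {set P} -> 'I_a.+1}) :
  isomorphic E F -> describes E m -> describes F m.
Proof.
case/existsP => p /forallP pP /describesP[kap [kE kc]].
apply/describesP; exists (kap \o (p^-1)%g); split.
  move=> x y; rewrite /= -(inj_eq (@perm_inj _ (p^-1)%g)) -kE.
  by move/forallP: (pP ((p^-1)%g x)) => /(_ ((p^-1)%g y)) /eqP ->; rewrite !permKV.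
move=> k; rewrite -kc -[RHS](card_imset _ (@perm_inj _ p)).
apply: eq_card => x; rewrite inE /=; apply/idP/imsetP.
  by move=> kx; exists ((p^-1)%g x); rewrite ?inE ?permKV.
by case=> y; rewrite inE => ky ->; rewrite permK.
Qed.

Lemma describes_act (P T : finType) a (E : {set T * T})
    (m : {ffun {set P} -> 'I_a.+1}) (s : {perm P}) :
  describes E m -> describes E (config_act m s).
Proof.
case/describesP => kap [kE kc]; apply/describesP.
pose relabel (k : color P) : color P :=
  match k with
  | Coatom i => Coatom (s i) | Atom B => Atom ((s^-1)%g @^-1: B) | _ => k
  end.
exists (relabel \o kap); split.
  move=> x y; rewrite kE /=; congr (_ || _).
  case: (kap x) => [[]|[i|B]]; case: (kap y) => [[]|[j|B']] //=.
  by rewrite inE permK.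
move=> k; pose unlabel (k : color P) : color P :=
  match k with
  | Coatom i => Coatom ((s^-1)%g i) | Atom B => Atom (s @^-1: B) | _ => k
  end.
have -> : color_count (config_act m s) k = color_count m (unlabel k).
  by case: k => [|[]] //= B; rewrite ffunE.
rewrite -kc; apply: eq_card => x; rewrite !inE /=.
have relabelK : cancel relabel unlabel.
  case=> [|[i|B]] //=; first by rewrite permK.
  by rewrite preim_preimV.
have unlabelK : cancel unlabel relabel.
  case=> [|[i|B]] //=; first by rewrite permKV.
  by have := preim_preimV (s^-1)%g B; rewrite invgK => ->.
by rewrite -[RHS](can_eq relabelK) unlabelK.
Qed.

(** Two colorings of the same order have the same coatoms, and comparing the two labels of each
    coatom yields the permutation. The block of an atom is read off from the coatoms above it, so it
    is carried along. *)
Lemma describes_orbit (P T : finType) a (E : {set T * T})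
    (m m' : {ffun {set P} -> 'I_a.+1}) (i0 : P) :
  m \in configs P a -> m' \in configs P a ->
  describes E m -> describes E m' ->
  m' \in orbit (config_action P a) [set: {perm P}] m.
Proof.
move=> cm cm' /describesP[kap [kE kc]] /describesP[kap' [kE' kc']].
have col := config_coloring cm kc kE; have col' := config_coloring cm' kc' kE'.
have posP i : {x | kap x == Coatom i}.
  by apply: sigW; have [x ex] := coloring_surj col (k := Coatom i) isT; exists x; apply/eqP.
pose pos i := sval (posP i).
have kpos i : kap (pos i) = Coatom i by apply/eqP/(svalP (posP i)).
(* The default is never reached: [pos i] is a coatom of the order, hence has a coatom color under
   [kap'] too. *)
pose lab i := if kap' (pos i) is Coatom j then j else i.
have klab i : kap' (pos i) = Coatom (lab i).
  have : pos i \in coatoms (rel_of E) by rewrite (coloring_coatoms col i0) inE kpos.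
  by rewrite (coloring_coatoms col' i0) inE /lab; case: (kap' _) => [|[]].
have lab_inj : injective lab.
  move=> i j e; have : pos i = pos j.
    by apply: (coloring_inj col'); rewrite !klab ?e.
  by move/(congr1 kap); rewrite !kpos => -[].
pose s := perm lab_inj.
apply/imsetP; exists s; rewrite ?inE //; apply/ffunP => B; apply/val_inj => /=.
rewrite ffunE -[LHS]/(color_count m' (Atom B)) -[RHS]/(color_count m (Atom _)).
rewrite -kc -kc'.
have key x C C' : kap x = Atom C -> kap' x = Atom C' -> C = s @^-1: C'.
  move=> ex ex'; apply/setP => i; rewrite inE permE.
  have := kE x (pos i); rewrite kE' ex ex' kpos klab /=.
  have [e|_ /= ->//] := eqVneq x (pos i).
  by move: ex; rewrite e kpos.
have at_eq x : is_atom (kap x) = is_atom (kap' x).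
  have := coloring_atoms col i0; rewrite (coloring_atoms col' i0) => /setP/(_ x).
  by rewrite !inE.
apply: eq_card => x; rewrite !inE; move: (at_eq x) (key x).
case: (kap x) => [|[i|C]]; case: (kap' x) => [|[j|C']] //= _ /(_ _ _ erefl erefl) ->.
apply/eqP/eqP => [[->] //|[e]].
by congr (Atom _); apply: preimset_perm_inj e.
Qed.

Lemma config_described (P : finType) a (m : {ffun {set P} -> 'I_a.+1}) :
  m \in configs P a -> exists E : {set 'I_(#|P| + a + 2) * 'I_(#|P| + a + 2)},
    describes E m.
Proof.
(* Each color is listed with its multiplicity: two entries for the bounds, one per coatom and [a]
   for the atoms. Positions in this list become the elements of the lattice. *)
move=> cm; pose s := flatten [seq nseq (color_count m k) k | k <- enum (color P)].
have size_s : size s = #|P| + a + 2.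
  rewrite size_flatten /shape -map_comp sumnE big_map big_enum /=.
  rewrite (eq_bigr (color_count m)) => [|k _]; last by rewrite /= size_nseq.
  rewrite big_sumType /= sum1_card card_bool big_sumType /= sum1_card addnC.
  congr (_ + _ + _).
  move: cm; rewrite inE => /and4P[_ /eqP ms _ _]; rewrite -[RHS]ms.
  exact: eq_bigl.
have cnt_s k : count_mem k s = color_count m k.
  rewrite count_flatten -map_comp sumnE big_map big_enum /= (bigD1 k) //=.
  rewrite count_nseq /= eqxx mul1n big1 ?addn0 // => k' k'k.
  by rewrite count_nseq /= (negPf k'k).
pose kap (x : 'I_(#|P| + a + 2)) : color P := nth Bot s x.
pose E := [set xy : 'I_(#|P| + a + 2) * 'I_(#|P| + a + 2) |
  (xy.1 == xy.2) || color_le (kap xy.1) (kap xy.2)].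
exists E; apply/describesP; exists kap; split.
  by move=> x y; rewrite /rel_of inE.
move=> k; rewrite -cnt_s -sum1dep_card -sum1_count.
by rewrite (big_nth Bot) size_s big_mkord.
Qed.

Lemma card_same_kernel (T U V : finType) (D : {set T}) (f : T -> U) (g : T -> V) :
  {in D &, forall x y, (f x == f y) = (g x == g y)} -> #|f @: D| = #|g @: D|.
Proof.
move=> h; pose fg x := (f x, g x).
have -> : f @: D = fst @: (fg @: D) by rewrite -imset_comp; apply: eq_imset.
have -> : g @: D = snd @: (fg @: D) by rewrite -imset_comp; apply: eq_imset.
transitivity #|fg @: D|; [|symmetry]; apply: card_in_imset;
  move=> _ _ /imsetP[x xD ->] /imsetP[y yD ->] /= e; rewrite /fg.
  by move/eqP: (e); rewrite h // => /eqP ->; rewrite e.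
by move/eqP: (e); rewrite -h // => /eqP ->; rewrite e.
Qed.

(** The isomorphism classes are the image of [D] under the class map. Sending a lattice to the orbit
    of a configuration that describes it has the same kernel, and reaches every orbit by
    [config_described]. *)
Lemma nb_rank3_lattices_orbits (P : finType) a (i0 : P) :
  nb_rank3_lattices #|P| a =
  #|orbit (config_action P a) [set: {perm P}] @: configs P a|.
Proof.
pose D := labeled_rank3_lattices #|P| a.
have describe E : E \in D -> {m | (m \in configs P a) && describes E m}.
  move=> ED; apply: sigW; move: ED; rewrite inE => lat.
  have [kap col] := rank3_coloring lat.
  have [|m mc cnt] := coloring_config (a := a) col.
    by rewrite -(coloring_atoms col i0); case/and4P: lat => _ _ _ /eqP.
  exists m; rewrite mc; apply/describesP; exists kap; split=> // x y.
  exact: coloring_rel col x y.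
pose conf (E : {set 'I_(#|P| + a + 2) * 'I_(#|P| + a + 2)}) :=
    odflt [ffun=> ord0] [pick m : {ffun {set P} -> 'I_a.+1} | (m \in configs P a) && describes E m].
have confP E : E \in D -> (conf E \in configs P a) /\ describes E (conf E).
  move=> ED; have [m mP] := describe E ED; rewrite /conf.
  by case: pickP => [m' /andP[]|/(_ m)] //=; rewrite mP.
have to_in_D E (m : {ffun {set P} -> 'I_a.+1}) : m \in configs P a -> describes E m -> E \in D.
  move=> mc /describesP[kap [kE kc]]; rewrite inE.
  apply: (coloring_rank3 (config_coloring mc kc kE) i0).
  have := sum_card_atoms kap xpredT; rewrite /= => <-.
  rewrite (eq_bigr (fun B => m B : nat)) => [|B _]; last by rewrite kc.
  by move: mc; rewrite inE => /and4P[_ /eqP].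
transitivity #|(fun E => orbit (config_action P a) [set: {perm P}] (conf E)) @: D|.
  apply: card_same_kernel => E F ED FD.
  have [cE dE] := confP E ED; have [cF dF] := confP F FD.
  rewrite /=; apply/eqP/eqP => [e|/orbit_eqP/imsetP[s _ e]].
    have : E \in [set F' in D | isomorphic E F'].
      by rewrite inE ED (isomorphic_equiv E E E).1.
    rewrite e inE => /andP[_ iFE].
    apply/orbit_eqP.
    exact: describes_orbit i0 cF cE (isomorphic_describes iFE dF) dE.
  have iEF : isomorphic E F.
    by apply: describes_isomorphic dE _; rewrite e; apply: describes_act.
  by apply/setP => G; rewrite !inE (isomorphic_equiv E F G).2.
congr #|pred_of_set _|; apply/setP => O; apply/imsetP/imsetP => [[E ED ->]|[m mc ->]].
  by exists (conf E) => //; case: (confP E ED).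
have [E dE] := config_described mc; have ED := to_in_D E m mc dE.
have [cE dE'] := confP E ED; exists E => //.
by apply/orbit_eqP/(describes_orbit i0 cE mc dE' dE).
Qed.

(** * Configurations fixed by a permutation *)

Definition nb_fixed (P : finType) a (s : {perm P}) : nat :=
  #|('Fix_(configs P a | config_action P a)[s])%g|.

Lemma burnside_rank3 (P : finType) a (i0 : P) :
  \sum_(s : {perm P}) nb_fixed a s = nb_rank3_lattices #|P| a * #|{perm P}|.
Proof.
rewrite (nb_rank3_lattices_orbits a i0) -cardsT -(Frobenius_Cauchy (acts_configs P a)).
by apply: eq_bigl => s; rewrite inE.
Qed.

Lemma nb_fixedP (P : finType) a (s : {perm P}) m :
  reflect (m \in configs P a /\ forall B : {set P}, m (s @^-1: B) = m B)
          (m \in ('Fix_(configs P a | config_action P a)[s])%g).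
Proof.
rewrite in_setI; apply: (iffP andP) => -[mc ms]; split=> //.
  by move=> B; move/afix1P: ms => /= /ffunP/(_ B); rewrite ffunE.
by apply/afix1P/ffunP => B; rewrite ffunE.
Qed.

Lemma nb_fixed_conj (P : finType) a (s g : {perm P}) :
  nb_fixed a (s ^ g)%g = nb_fixed a s.
Proof.
suff le (s' g' : {perm P}) : nb_fixed a s' <= nb_fixed a (s' ^ g')%g.
  by apply/eqP; rewrite eqn_leq le -[X in _ <= nb_fixed a X](conjgK g) le.
rewrite /nb_fixed -(card_imset _ (@act_inj _ _ _ (config_action P a) g')).
apply/subset_leq_card/subsetP => _ /imsetP[m mF ->].
move: mF; rewrite !in_setI => /andP[mc /afix1P ms]; apply/andP; split.
  exact: config_act_in.
by apply/afix1P; rewrite -actCJ ms.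
Qed.

Definition linear_families (P : finType) (s : {perm P}) : {set {set {set P}}} :=
  [set L : {set {set P}} | [&& [forall B in L, 1 < #|B|],
     [forall B in L, forall C in L, (B != C) ==> (#|B :&: C| <= 1)] &
     [forall B : {set P}, (s @^-1: B \in L) == (B \in L)]]].

Definition family_weight (P : finType) (L : {set {set P}}) : nat :=
  #|L| + #|~: cover L|.

Lemma linear_familiesP (P : finType) (s : {perm P}) (L : {set {set P}}) :
  reflect [/\ forall B, B \in L -> 1 < #|B|,
    forall B C, B \in L -> C \in L -> B != C -> #|B :&: C| <= 1 &
    forall B : {set P}, (s @^-1: B \in L) = (B \in L)] (L \in linear_families s).
Proof.
rewrite inE; apply: (iffP and3P) => -[h1 h2 h3]; split.
- exact/forall_inP.
- move=> B C BL CL BC.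
  by move/forall_inP: h2 => /(_ B BL) /forall_inP /(_ C CL); rewrite BC.
- by move=> B; apply/eqP; move/forallP: h3.
- exact/forall_inP.
- apply/forall_inP => B BL; apply/forall_inP => C CL; apply/implyP.
  exact: h2.
- by apply/forallP => B; rewrite h3.
Qed.

Lemma sum_sets_by_card (P : finType) (F : {set P} -> nat) :
  \sum_B F B = F set0 + \sum_i F [set i] + \sum_(B : {set P} | 1 < #|B|) F B.
Proof.
rewrite (bigID (fun B : {set P} => 1 < #|B|)) /= addnC; congr (_ + _).
rewrite (bigD1 set0) /= ?cards0 //; congr (_ + _).
have <- : \sum_(B in [set [set i] | i in [set: P]]) F B = \sum_i F [set i].
  by rewrite big_imset /= => [|i j _ _ /set1_inj //]; apply: eq_bigl => i; rewrite inE.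
rewrite big_mkcond [RHS]big_mkcond; apply: eq_bigr => B _.
rewrite -leqNgt -card_gt0; congr (if _ then _ else _).
apply/idP/imsetP => [/andP[h1 h0]|[i _ ->]]; last by rewrite cards1.
have /cards1P[i ->] : #|B| == 1 by rewrite eqn_leq h1.
by exists i.
Qed.

Lemma codegree_card_gt1 (P : finType) (B : {set P}) i j :
  i != j -> i \in B -> j \in B -> 1 < #|B|.
Proof. by move=> ij iB jB; apply/card_gt1P; exists i, j. Qed.

Section FixedConfigs.
Variables (P I : finType) (s : {perm P}) (idx : P -> I) (a : nat).
Hypothesis idx_surj : forall j, exists i, idx i == j.
Hypothesis idx_invariant : forall i, idx (s i) = idx i.
Hypothesis idx_orbit : forall i j, idx i = idx j -> exists e, j = iter e s i.

(** Here [idx] numbers the cycles of [s], so the weights are the cycle lengths. The unknown [k j] is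
    the number of optional atoms on each point of the cycle [j]. *)
Definition weighted_solutions t : {set {ffun I -> 'I_a.+1}} :=
  [set k : {ffun I -> 'I_a.+1} | \sum_j #|[set i | idx i == j]| * k j == t].

Let rep j : P := xchoose (idx_surj j).
Let idx_rep j : idx (rep j) = j. Proof. exact/eqP/(xchooseP (idx_surj j)). Qed.

Let sum_idx (k : I -> nat) :
  \sum_i k (idx i) = \sum_j #|[set i | idx i == j]| * k j.
Proof.
rewrite (partition_big idx xpredT) //=; apply: eq_bigr => j _.
rewrite (eq_bigr (fun=> k j)) => [|i /eqP -> //].
by rewrite sum_nat_cond_const; congr (_ * _); apply: eq_card => i; rewrite !inE.
Qed.

Let invariantE (T : eqType) (v : P -> T) : (forall i, v (s i) = v i) ->
  forall i j, idx i = idx j -> v i = v j.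
Proof.
by move=> vs i j /idx_orbit[e ->]; elim: e => //= e ->; rewrite vs.
Qed.

Definition big_blocks (m : {ffun {set P} -> 'I_a.+1}) : {set {set P}} :=
  [set B : {set P} | (1 < #|B|) && (0 < m B)].

Lemma big_blocks_linear m : m \in ('Fix_(configs P a | config_action P a)[s])%g ->
  big_blocks m \in linear_families s.
Proof.
case/nb_fixedP; rewrite inE => /and4P[m0 _ /forallP lin _] ms.
apply/linear_familiesP; split.
- by move=> B; rewrite inE => /andP[].
- move=> B C; rewrite !inE => /andP[_ mB] /andP[_ mC] BC.
  rewrite leqNgt; apply/negP => /card_gt1P[i [j []]]; rewrite !inE.
  move=> /andP[iB iC] /andP[jB jC] ij.
  have := lin i => /forallP/(_ j); rewrite ij /=.
  (* Each of the two blocks contributes at least one to a sum bounded by one. *)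
  rewrite (bigD1 B) ?iB //= (bigD1 C) /= ?iC ?jC 1?eq_sym ?BC //.
  by case: (m B : nat) mB (m C : nat) mC => [|x] // _ [|y] // _; rewrite addSn addnCA addSn.
by move=> B; rewrite !inE ms card_preimset //; apply: perm_inj.
Qed.

Section Fiber.
Variable L : {set {set P}}.
Hypothesis linL : L \in linear_families s.

Let L_card B : B \in L -> 1 < #|B|. Proof. by case/linear_familiesP: linL => h _ _; apply: h. Qed.
Let L_lin B C : B \in L -> C \in L -> B != C -> #|B :&: C| <= 1.
Proof. by case/linear_familiesP: linL => _ h _; apply: h. Qed.
Let L_inv (B : {set P}) : (s @^-1: B \in L) = (B \in L).
Proof. by case/linear_familiesP: linL => _ _ h; apply: h. Qed.

Let cover_inv i : (s i \in cover L) = (i \in cover L).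
Proof.
apply/bigcupP/bigcupP => -[B BL iB].
  by exists (s @^-1: B); rewrite ?L_inv ?inE.
exists ((s^-1)%g @^-1: B); last by rewrite inE permK.
by rewrite -L_inv preim_preimV.
Qed.

(** The mandatory atom on an uncovered point is kept apart, so that [k] is otherwise
    unconstrained. *)
Let point_mult (k : {ffun I -> 'I_a.+1}) i : nat := k (idx i) + (i \notin cover L).

(** The sum treats the sets of size at most one uniformly: it vanishes on the empty set and is
    [point_mult] on a singleton. *)
Let mult (k : {ffun I -> 'I_a.+1}) (B : {set P}) : nat :=
  if 1 < #|B| then nat_of_bool (B \in L) else \sum_(i in B) point_mult k i.

Let mult_sum (k : {ffun I -> 'I_a.+1}) : \sum_B mult k B =
  \sum_j #|[set i | idx i == j]| * k j + family_weight L.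
Proof.
rewrite sum_sets_by_card /mult cards0 /= big_set0 add0n.
rewrite (eq_bigr (point_mult k)) => [|i _]; last by rewrite cards1 big_set1.
rewrite big_split /= (sum_idx (fun j => k j)) -addnA; congr (_ + _).
rewrite /family_weight addnC; congr (_ + _).
  rewrite -sum1_card [RHS]big_mkcond [LHS]big_mkcond /=; apply: eq_bigr => B _.
  by have [/L_card ->|] := boolP (B \in L); last by case: (1 < #|B|).
by rewrite -sum1_card [RHS]big_mkcond; apply: eq_bigr => i _; rewrite inE; case: (_ \in _).
Qed.

Let mult_le (k : {ffun I -> 'I_a.+1}) B :
  \sum_j #|[set i | idx i == j]| * k j + family_weight L = a ->
  mult k B <= a.
Proof. by rewrite -mult_sum => <-; rewrite (bigD1 B) //= leq_addr. Qed.

Let build (k : {ffun I -> 'I_a.+1}) : {ffun {set P} -> 'I_a.+1} :=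
  [ffun B => inord (mult k B)].

Let buildE k B : family_weight L <= a ->
  k \in weighted_solutions (a - family_weight L) -> build k B = mult k B :> nat.
Proof.
move=> le; rewrite inE => /eqP e; rewrite ffunE inordK // ltnS mult_le //.
by rewrite e subnK.
Qed.

(** Once [L] is fixed, the only freedom lies in the optional atoms on singletons, whose number is
    constant along each cycle; [build] is the resulting bijection. If the weight exceeds [a], the
    mandatory atoms are already too many. *)
Lemma fixed_configs_fiber :
  #|[set m in ('Fix_(configs P a | config_action P a)[s])%g | big_blocks m == L]| =
  if family_weight L <= a then #|weighted_solutions (a - family_weight L)| else 0.
Proof.
have fiberP m :
    m \in [set m in ('Fix_(configs P a | config_action P a)[s])%g | big_blocks m == L] ->
    family_weight L <= a /\ exists2 k, k \in weighted_solutions (a - family_weight L) & m = build k.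
  rewrite inE => /andP[/nb_fixedP[]].
  rewrite inE => /and4P[/eqP m0 /eqP msum /forallP lin /forallP cov] ms /eqP eL.
  (* Such a block has two distinct points, and linearity bounds the number of atoms below both by
     one. *)
  have m_le1 (B : {set P}) : 1 < #|B| -> m B = (B \in L) :> nat.
    move=> B1; rewrite -eL inE B1 /=.
    have /card_gt1P[i [j [iB jB ij]]] := B1.
    have := lin i => /forallP/(_ j); rewrite ij /= (bigD1 B) ?iB //=.
    by case: (m B : nat) => [|[|]] // n; rewrite addSn.
  have cov' i : i \notin cover L -> 0 < m [set i].
    move=> iL; have /existsP[B /andP[iB mB]] := cov i.
    have [B1|B1] := ltnP 1 #|B|.
      by case/bigcupP: iL; exists B; rewrite // -eL inE B1.
    suff -> : [set i] = B by [].
    by apply/eqP; rewrite eqEcard sub1set iB cards1.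
  (* The truncated subtraction is exact: by [cov'] an uncovered point carries at least one atom of
     its own. *)
  pose v i : nat := m [set i] - (i \notin cover L).
  have v_inv i : v (s i) = v i.
    rewrite /v cover_inv -(ms [set s i]); congr (nat_of_ord (m _) - _).
    by apply/setP => x; rewrite !inE (inj_eq perm_inj).
  pose k : {ffun I -> 'I_a.+1} := [ffun j => inord (v (rep j))].
  have kE i : k (idx i) = v i :> nat.
    rewrite ffunE inordK.
      by apply: invariantE => //; rewrite idx_rep.
    by apply: leq_ltn_trans (leq_subr _ _) _; rewrite ltn_ord.
  have mE (B : {set P}) : m B = mult k B :> nat.
    rewrite /mult; case: ifP => [|/negbT]; first exact: m_le1.
    rewrite -leqNgt leq_eqVlt => /orP[/cards1P[i ->]|].
      rewrite big_set1 /point_mult kE /v subnK //.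
      by case: (boolP (i \in cover L)) => //= /cov'.
    by rewrite ltnS leqn0 cards_eq0 => /eqP ->; rewrite big_set0.
  have tot : \sum_j #|[set i | idx i == j]| * k j + family_weight L = a.
    by rewrite -mult_sum -[RHS]msum; apply: eq_bigr => B _; rewrite mE.
  have le : family_weight L <= a by rewrite -tot leq_addl.
  have kW : k \in weighted_solutions (a - family_weight L).
    by rewrite inE -[X in X - _]tot addnK.
  split=> //; exists k => //; apply/ffunP => B; apply/val_inj => /=.
  by rewrite buildE // mE.
case: ifP => [le|/negP gt]; last first.
  by apply: eq_card0 => m; apply/negP => /fiberP[].
rewrite -(card_in_imset (f := build)); last first.
  move=> k k' kW k'W /ffunP e; apply/ffunP => j; apply/val_inj => /=.
  have /(congr1 (@nat_of_ord _)) := e [set rep j].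
  rewrite !buildE // /mult cards1 /= !big_set1 /point_mult idx_rep.
  exact: addIn.
apply: eq_card => m; apply/idP/imsetP => [/fiberP[_ [k kW ->]]|[k kW ->]].
  by exists k.
have bE := fun B => buildE B le kW.
rewrite inE; apply/andP; split; last first.
  apply/eqP/setP => B; rewrite inE bE /mult.
  by case: ifP => B1; [case: (_ \in _)|rewrite /=; apply/esym/negP => /L_card; rewrite B1].
apply/nb_fixedP; split; last first.
  move=> B; apply/val_inj => /=; rewrite !bE /mult card_preimset; last exact: perm_inj.
  case: ifP => // _; first by rewrite L_inv.
  rewrite [RHS](reindex_inj (@perm_inj _ s)) /=; apply: eq_big => i; first by rewrite inE.
  by rewrite /point_mult idx_invariant cover_inv.
rewrite inE; apply/and4P; split.
- by rewrite bE /mult cards0 big_set0.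
- rewrite (eq_bigr (mult k)) => [|B _]; last by rewrite bE.
  by rewrite mult_sum; move: kW; rewrite inE => /eqP ->; rewrite subnK.
- apply/forallP => i; apply/forallP => j; apply/implyP => ij.
  rewrite (eq_bigr (fun B : {set P} => nat_of_bool (B \in L))); last first.
    by move=> B /andP[iB jB]; rewrite bE /mult (codegree_card_gt1 ij iB jB).
  rewrite -big_mkcondr sum1dep_card; apply/card_le1_eqP => B C; rewrite !inE.
  move=> /andP[/andP[iB jB] BL] /andP[/andP[iC jC] CL]; apply/eqP/negP => /negP CB.
  have := L_lin CL BL CB; rewrite leqNgt (@codegree_card_gt1 _ _ i j) // inE; exact/andP.
apply/forallP => i; have [|iL] := boolP (i \in cover L).
  case/bigcupP => B BL iB; apply/existsP; exists B.
  by rewrite iB bE /mult L_card // BL.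
apply/existsP; exists [set i]; rewrite inE eqxx bE /mult cards1 big_set1.
by rewrite /point_mult iL addn1.
Qed.

End Fiber.

Lemma nb_fixed_sum :
  nb_fixed a s = \sum_(L in linear_families s)
    if family_weight L <= a then #|weighted_solutions (a - family_weight L)| else 0.
Proof.
rewrite /nb_fixed -sum1_card (partition_big big_blocks (mem (linear_families s))) /=.
  apply: eq_bigr => L linL; rewrite -fixed_configs_fiber // -sum1_card.
  by apply: eq_bigl => m; rewrite [RHS]inE.
exact: big_blocks_linear.
Qed.

End FixedConfigs.

(** * Computing the moments of the weight of linear families *)

(* The entries are the binomial moments of order 0 to 3 of a family of weights. *)
Definition vec : Type := N * N * N * N.
Definition vadd (u v : vec) : vec :=
  let: (u0, u1, u2, u3) := u in let: (v0, v1, v2, v3) := v in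
  (N.add u0 v0, N.add u1 v1, N.add u2 v2, N.add u3 v3).
(* Pascal's rule: effect on the binomial moments of adding 1 to every weight. *)
Definition vshift (v : vec) : vec :=
  let: (v0, v1, v2, v3) := v in
  (v0, N.add v0 v1, N.add v1 v2, N.add v2 v3).
Definition vzero : vec := (0%num, 0%num, 0%num, 0%num).
Definition vone : vec := (1%num, 0%num, 0%num, 0%num).

(* The items of [small] are pairwise compatible, so once [big] is exhausted the
   sum over cliques is a product. *)
Fixpoint clique_moments (X : Type) (compat : rel X) (w : X -> nat)
    (fuel : nat) (big small : seq X) : vec :=
  match fuel, big with
  | k.+1, o :: r =>
    vadd (clique_moments compat w k r small)
         (iter (w o) vshift
            (clique_moments compat w k (filter (compat o) r)
                            (filter (compat o) small)))
  | _, _ => foldr (fun o v => vadd v (iter (w o) vshift v)) vone small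
  end.

Fixpoint at_most_one_common (seen : bool) (b c : bitseq) : bool :=
  match b, c with
  | x :: b', y :: c' =>
    if x && y then ~~ seen && at_most_one_common true b' c'
    else at_most_one_common seen b' c'
  | _, _ => true
  end.

Definition bits_compat : rel bitseq := at_most_one_common false.
Definition orbits_compat : rel (seq bitseq) :=
  fun o o' => all (fun b => all (bits_compat b) o') o.

Definition all_bits : seq bitseq :=
  iter 7 (fun l => map (cons true) l ++ map (cons false) l) [:: [::]].

(** Decreasing size lets the recursion meet the most restrictive blocks first. *)
Definition all_blocks : seq bitseq :=
  flatten [seq [seq b <- all_bits | count id b == k] | k <- [:: 7; 6; 5; 4; 3; 2]].

Definition bits_act (s : seq nat) (b : bitseq) : bitseq := map (nth false b) s.

(* A permutation of seven points with at least four cycles has order dividing 12. *)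
Definition bits_orbit s b := undup (traject (bits_act s) b 12).

Definition block_orbits s : seq (seq bitseq) :=
  foldl (fun os b => if b \in flatten os then os else rcons os (bits_orbit s b))
        [::] all_blocks.

Definition linear_orbit (o : seq bitseq) : bool :=
  all (fun b => all (fun c => (b == c) || bits_compat b c) o) o.

Definition linear_orbits s := [seq o <- block_orbits s | linear_orbit o].

Definition bits_and (b c : bitseq) : bitseq :=
  map (fun p => p.1 && p.2) (zip b c).

Definition misses (J : bitseq) (o : seq bitseq) : bool :=
  all (fun b => ~~ has id (bits_and J b)) o.

(** The blocks of an orbit have equal size, so the first one decides. Orbits that are not big
    consist of pairs and are therefore mutually compatible. *)
Definition is_big (o : seq bitseq) := 2 < count id (head [::] o).

Definition moments_avoiding os J : vec :=
  let os' := [seq o <- os | misses J o] in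
  clique_moments orbits_compat size (size os')
    [seq o <- os' | is_big o] [seq o <- os' | ~~ is_big o].

(** A test set of [k] points accounts for [k] units of the order, so its moment of order [j - k]
    enters the total at order [j]. *)
Definition vdelay (v : vec) : vec :=
  let: (v0, v1, v2, v3) := v in (0%num, v0, v1, v2).

Definition vsum : seq vec -> vec := foldr vadd vzero.

(* If [w = x + u] with [u] the number of uncovered points, then by Vandermonde
   'C(w, j) is the sum over k of 'C(x, j - k) times the number of [k]-sets [J] of
   uncovered points; the result is meaningful up to order [d] only. *)
Definition moments s d : vec :=
  let os := linear_orbits s in
  vsum [seq vsum [seq iter k vdelay (moments_avoiding os J)
                 | J <- [seq J <- all_bits | count id J == k]]
       | k <- iota 0 d.+1].

Definition vnth (v : vec) (j : nat) : nat :=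
  let: (v0, v1, v2, v3) := v in
  nth 0 [:: N.to_nat v0; N.to_nat v1; N.to_nat v2; N.to_nat v3] j.

Definition vrep (v : vec) (f : nat -> nat) : Prop :=
  forall j, j < 4 -> vnth v j = f j.

Lemma vrep_add u v f g : vrep u f -> vrep v g -> vrep (vadd u v) (fun j => f j + g j).
Proof.
case: u => [[[u0 u1] u2] u3]; case: v => [[[v0 v1] v2] v3] hu hv j j4.
rewrite -hu // -hv //; move: j4; case: j => [|[|[|[|//]]]] _ /=; exact: N2Nat.inj_add.
Qed.

Lemma vrep_ext v f g : (forall j, j < 4 -> f j = g j) -> vrep v f -> vrep v g.
Proof. by move=> fg h j j4; rewrite h ?fg. Qed.

Lemma vrep_shift v (I : finType) (A : pred I) (h : I -> nat) w :
  vrep v (fun j => \sum_(i | A i) 'C(h i, j)) ->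
  vrep (iter w vshift v) (fun j => \sum_(i | A i) 'C(w + h i, j)).
Proof.
elim: w => [|w IH] hv; first exact: hv.
move: (IH hv); rewrite iterS; case: (iter w vshift v) => [[[v0 v1] v2] v3] hw.
case=> [|j] j4; first by have := hw 0 isT => /= ->; apply: eq_bigr => i _; rewrite !bin0.
transitivity (\sum_(i | A i) 'C(w + h i, j) + \sum_(i | A i) 'C(w + h i, j.+1)).
  rewrite -hw ?(ltnW j4) // -hw //; move: j4.
  by case: j => [|[|[|//]]] _ /=; apply: N2Nat.inj_add.
by rewrite -big_split; apply: eq_bigr => i _; rewrite addSn binS /= [RHS]addnC.
Qed.

Lemma vrep_delay v f k :
  vrep v f -> vrep (iter k vdelay v) (fun j => if k <= j then f (j - k) else 0).
Proof.
elim: k => [|k IH] hv; first by move=> j j4; rewrite subn0 -hv.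
move: (IH hv); rewrite iterS; case: (iter k vdelay v) => [[[v0 v1] v2] v3] h.
by case=> [|j] j4 //; rewrite subSS -(h j (ltnW j4)); case: j j4 => [|[|[|]]].
Qed.

Lemma vrep_sum (X : eqType) (r : seq X) (F : X -> vec) (f : X -> nat -> nat) :
  {in r, forall x, vrep (F x) (f x)} ->
  vrep (vsum (map F r)) (fun j => \sum_(x <- r) f x j).
Proof.
elim: r => [|x r IH] h.
  by move=> j j4; rewrite big_nil; case: j j4 => [|[|[|[|]]]].
apply: vrep_ext (vrep_add (h x (mem_head _ _)) (IH _)) => [j _|y yr].
  by rewrite big_cons.
by apply: h; rewrite inE yr orbT.
Qed.

(** * Moments over unions of pairwise compatible orbits *)

Section Cliques.
Variables (X : finType) (compat : rel X).
Hypothesis compat_sym : symmetric compat.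

Definition clique_unions (os : seq (seq X)) : {set {set X}} :=
  [set L : {set X} | [&& [forall x in L, x \in flatten os],
     all (fun o : seq X => all (fun x => x \in L) o || ~~ has (fun x => x \in L) o) os &
     [forall x in L, forall y in L, (x != y) ==> compat x y]]].

Lemma clique_unionsP os (L : {set X}) : reflect
  [/\ forall x, x \in L -> x \in flatten os,
      forall o x y, o \in os -> x \in o -> y \in o -> x \in L -> y \in L &
      forall x y, x \in L -> y \in L -> x != y -> compat x y]
  (L \in clique_unions os).
Proof.
rewrite inE; apply: (iffP and3P) => -[h1 h2 h3]; split.
- exact/forall_inP.
- move=> o x y oos xo yo xL; move/allP: h2 => /(_ o oos) /orP[/allP -> //|].
  by case/hasP; exists x.
- by move=> x y xL yL xy; move/forall_inP: h3 => /(_ x xL) /forall_inP/(_ y yL); rewrite xy.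
- exact/forall_inP.
- apply/allP => o oos; rewrite orbC -implybE; apply/implyP => /hasP[x xo xL].
  by apply/allP => y yo; apply: (h2 o x).
apply/forall_inP => x xL; apply/forall_inP => y yL; apply/implyP; exact: h3.
Qed.

Lemma clique_unions_nil : clique_unions [::] = [set set0].
Proof.
apply/setP => L; rewrite !inE /=; apply/idP/eqP => [/andP[/forall_inP h _]|->].
  by apply/setP => x; rewrite in_set0; apply/negP => /h; rewrite in_nil.
by apply/andP; split; apply/forall_inP => x; rewrite in_set0.
Qed.

Definition seqs_compat : rel (seq X) :=
  fun o o' => all (fun x => all (compat x) o') o.

Lemma uniq_flatten_mem (os : seq (seq X)) o o' x : uniq (flatten os) ->
  o \in os -> o' \in os -> x \in o -> x \in o' -> o = o'.
Proof.
elim: os => //= p os IH; rewrite cat_uniq => /and3P[_ /hasPn dis us].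
have disj : x \in p -> x \in flatten os -> False by move=> xp /dis; rewrite /= xp.
rewrite !inE => /orP[/eqP->|oos] /orP[/eqP->|o'os] xo xo' //.
- by case: disj => //; apply/flattenP; exists o'.
- by case: disj => //; apply/flattenP; exists o.
exact: IH.
Qed.

Lemma subseq_flatten_filter (Y : eqType) (p : pred (seq Y)) os :
  subseq (flatten (filter p os)) (flatten os).
Proof.
elim: os => //= o os IH; case: (p o) => /=; first by rewrite cat_subseq.
exact: subseq_trans IH (suffix_subseq _ _).
Qed.

Definition self_compat (o : seq X) : Prop :=
  o != [::] /\ {in o &, forall x y, x != y -> compat x y}.

(** A family that avoids [o] is counted by the first sum. A family that meets [o] contains all of
    it, and what remains is a union of orbits compatible with [o]. Nonemptiness of [o], part of
    [self_compat], keeps the two cases disjoint. *)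
Lemma sum_clique_unions_cons o os (g : nat -> nat) :
  uniq (flatten (o :: os)) -> self_compat o ->
  \sum_(L in clique_unions (o :: os)) g #|L| =
  \sum_(L in clique_unions os) g #|L| +
  \sum_(L in clique_unions (filter (seqs_compat o) os)) g (size o + #|L|).
Proof.
rewrite /= cat_uniq => /and3P[uo /hasPn dis uos] [o0 oc].
have disj x : x \in o -> x \in flatten os -> False.
  by move=> xo /dis; rewrite /= xo.
rewrite (bigID (fun L : {set X} => has (fun x => x \in L) o)) /= addnC; congr (_ + _).
  apply: eq_bigl => L; apply/andP/idP => [[/clique_unionsP[h1 h2 h3] /hasPn no]|].
    apply/clique_unionsP; split=> // [x xL|o' x y o'os]; last first.
      by apply: h2; rewrite inE o'os orbT.
    move: (h1 x xL); rewrite /= mem_cat => /orP[xo|//].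
    by move: (no x xo); rewrite xL.
  move=> /clique_unionsP[h1 h2 h3]; have no : {in o, forall x, x \notin L}.
    by move=> x xo; apply/negP => /h1 /disj; apply.
  split; last by apply/hasPn.
  apply/clique_unionsP; split=> // [x /h1|o' x y]; first by rewrite /= mem_cat orbC => ->.
  rewrite inE => /orP[/eqP -> xo|o'os]; first by move/no: xo => /negPf ->.
  exact: h2 o'os.
pose So := [set x in o].
rewrite (reindex_onto (fun L => So :|: L) (fun L => L :\: So)) /=; last first.
  move=> L /andP[/clique_unionsP[_ h2 _] /hasP[x xo xL]].
  apply/setP => y; rewrite !inE; have [yo /=|//] := boolP (y \in o).
  by apply/esym/(h2 o x y) => //; rewrite mem_head.
have flt o' : o' \in filter (seqs_compat o) os -> o' \in os by rewrite mem_filter => /andP[].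
have fltf x : x \in flatten (filter (seqs_compat o) os) -> x \in flatten os.
  exact: mem_subseq (subseq_flatten_filter _ _) _.
have card_oL (L : {set X}) : [disjoint So & L] -> #|So :|: L| = size o + #|L|.
  by rewrite -leq_card_setU => /eqP ->; rewrite cardsE (card_uniqP uo).
apply: eq_big => [L|L]; last first.
  case/andP => _ /eqP e; rewrite card_oL // -setI_eq0 -e.
  by apply/eqP/setP => x; rewrite !inE; case: (x \in o).
apply/andP/idP => [[/andP[/clique_unionsP[h1 h2 h3] _] /eqP e]|].
  have nL x : x \in L -> x \notin o by rewrite -e !inE => /andP[].
  have Lf x : x \in L -> exists2 o', o' \in filter (seqs_compat o) os & x \in o'.
    move=> xL; have := h1 x; rewrite !inE xL orbT /= mem_cat (negPf (nL x xL)) /=.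
    move=> /(_ isT)/flattenP[o' o'os xo']; exists o' => //.
    rewrite mem_filter o'os andbT; apply/allP => y yo; apply/allP => z zo'.
    apply: h3; rewrite ?inE ?yo //.
      have := h2 o' x z; rewrite !inE o'os xL !orbT => -> //.
    by apply/eqP => yz; apply: (disj y yo); apply/flattenP; exists o'; rewrite // yz.
  apply/clique_unionsP; split.
  - by move=> x /Lf[o' o'f xo']; apply/flattenP; exists o'.
  - move=> o' x y o'f xo' yo' xL; have := h2 o' x y.
    rewrite !inE flt // xL !orbT => /(_ isT xo' yo' isT) /orP[yo|//].
    by case: (disj y yo); apply/flattenP; exists o'; rewrite ?flt.
  by move=> x y xL yL; apply: h3; rewrite !inE ?xL ?yL orbT.
move=> /clique_unionsP[h1 h2 h3].
have nL x : x \in L -> x \notin o by move=> /h1/fltf xf; apply/negP => /disj; apply.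
split; last first.
  apply/eqP/setP => x; rewrite !inE; have [xL|] := boolP (x \in L).
    by rewrite nL // orbT.
  by rewrite orbF andbC andbN.
have oL x y : x \in o -> y \in L -> compat x y.
  move=> xo /h1/flattenP[o']; rewrite mem_filter => /andP[/allP/(_ x xo)/allP h _].
  exact: h.
apply/andP; split; last first.
  have [x xo] : exists x, x \in o by case: (o) o0 => // x s _; exists x; rewrite mem_head.
  by apply/hasP; exists x; rewrite // !inE xo.
apply/clique_unionsP; split.
- move=> x; rewrite !inE /= mem_cat => /orP[->//|/h1/fltf ->]; exact: orbT.
- move=> o' x y; rewrite inE => /orP[/eqP -> _ yo _|o'os xo' yo']; first by rewrite !inE yo.
  rewrite !inE => /orP[xo|xL].
    by case: (disj x xo); apply/flattenP; exists o'.
  have /flattenP[o'' o''f xo''] := h1 x xL.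
  have e := uniq_flatten_mem uos o'os (flt o'' o''f) xo' xo''; subst o''.
  by rewrite (h2 o' x y) ?orbT.
move=> x y; rewrite !inE => /orP[xo|xL] /orP[yo|yL] xy.
- exact: oc.
- exact: oL.
- by rewrite compat_sym oL.
- exact: h3.
Qed.

(** Here filtering by compatibility removes nothing, so taking or leaving an orbit leads to the same
    remaining sum. *)
Lemma clique_moments_small (small : seq (seq X)) :
  uniq (flatten small) -> {in small, forall o, self_compat o} ->
  {in small &, forall o o', o != o' -> seqs_compat o o'} ->
  vrep (foldr (fun o v => vadd v (iter (size o) vshift v)) vone small)
       (fun j => \sum_(L in clique_unions small) 'C(#|L|, j)).
Proof.
elim: small => [|o r IH] /= us sc co.
  move=> j j4; rewrite clique_unions_nil big_set1 cards0.
  by case: j j4 => [|[|[|[|]]]].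
have [uo dis ur] : [/\ uniq o, ~~ has (mem o) (flatten r) & uniq (flatten r)].
  by apply/and3P; rewrite -cat_uniq.
have h : vrep (foldr (fun o v => vadd v (iter (size o) vshift v)) vone r)
    (fun j => \sum_(L in clique_unions r) 'C(#|L|, j)).
  apply: IH => //; first by move=> o' o'r; apply: sc; rewrite inE o'r orbT.
  by move=> o1 o2 h1 h2; apply: co; rewrite inE ?h1 ?h2 orbT.
apply: vrep_ext (vrep_add h (vrep_shift (size o) h)) => j _.
rewrite (sum_clique_unions_cons (fun n => 'C(n, j)) us); last by apply: sc; rewrite mem_head.
suff -> : filter (seqs_compat o) r = r by [].
apply/all_filterP/allP => o' o'r; apply: co; rewrite ?mem_head ?inE ?o'r ?orbT //.
apply: contraNneq dis => e; have [o0 _] := sc o (mem_head _ _).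
have [x xo] : exists x, x \in o by case: (o) o0 => // x s _; exists x; rewrite mem_head.
by apply/hasP; exists x => //; apply/flattenP; exists o'; rewrite // -e.
Qed.

(** As [fuel] bounds the length of [big], the base case is reached only with [big] exhausted. *)
Lemma clique_momentsP fuel (big small : seq (seq X)) :
  size big <= fuel -> uniq (flatten (big ++ small)) ->
  {in big ++ small, forall o, self_compat o} ->
  {in small &, forall o o', o != o' -> seqs_compat o o'} ->
  vrep (clique_moments seqs_compat size fuel big small)
       (fun j => \sum_(L in clique_unions (big ++ small)) 'C(#|L|, j)).
Proof.
elim: fuel big small => [|fuel IH] [|o r] small //= sz us sc co;
  try exact: clique_moments_small.
have [_ _ ur] : [/\ uniq o, ~~ has (mem o) (flatten (r ++ small)) & uniq (flatten (r ++ small))].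
  by apply/and3P; rewrite -cat_uniq.
have sc' : {in r ++ small, forall o, self_compat o}.
  by move=> o' o'r; apply: sc; rewrite inE o'r orbT.
have h1 := IH r small sz ur sc' co.
have h2 : vrep (clique_moments seqs_compat size fuel (filter (seqs_compat o) r)
     (filter (seqs_compat o) small))
   (fun j => \sum_(L in clique_unions (filter (seqs_compat o) (r ++ small))) 'C(#|L|, j)).
  rewrite filter_cat; apply: IH.
  - by rewrite size_filter (leq_trans (count_size _ _)).
  - by rewrite -filter_cat (subseq_uniq (subseq_flatten_filter _ _)).
  - by move=> o'; rewrite -filter_cat mem_filter => /andP[_ /sc'].
  by move=> o1 o2; rewrite !mem_filter => /andP[_ h] /andP[_ h']; apply: co.
apply: vrep_ext (vrep_add h1 (vrep_shift (size o) h2)) => j _.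
by rewrite (sum_clique_unions_cons (fun n => 'C(n, j)) us) //; apply: sc; rewrite mem_head.
Qed.

End Cliques.

(** Transfers the recursion from bit sequences, on which it is evaluated, to sets, on which it is
    proved correct. The predicate [p] will say that all sequences have length seven. *)
Lemma clique_moments_map (X Y : Type) (h : X -> Y) (p : pred X) (cX : rel X) (cY : rel Y)
    (wX : X -> nat) (wY : Y -> nat) fuel big small :
  (forall x y, p x -> p y -> cY (h x) (h y) = cX x y) ->
  (forall x, p x -> wY (h x) = wX x) -> all p big -> all p small ->
  clique_moments cY wY fuel (map h big) (map h small) = clique_moments cX wX fuel big small.
Proof.
move=> hc hw.
have filterE x l : p x -> all p l -> filter (cY (h x)) (map h l) = map h (filter (cX x) l).
  move=> px; elim: l => //= y l IH /andP[py pl].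
  by rewrite hc // IH //; case: ifP.
have filterP x l : all p l -> all p (filter (cX x) l).
  by rewrite all_filter; apply: sub_all => y /= ->; rewrite implybT.
have base l : all p l ->
    foldr (fun o v => vadd v (iter (wY o) vshift v)) vone (map h l) =
    foldr (fun o v => vadd v (iter (wX o) vshift v)) vone l.
  by elim: l => //= y l IH /andP[py pl]; rewrite IH // hw.
elim: fuel big small => [|fuel IH] [|o r] small //=; try by move=> _; apply: base.
move=> /andP[po pr] ps; rewrite hw // IH // !filterE // IH //; exact: filterP.
Qed.

(** * Subsets of seven points as bit sequences *)

Definition set_of_bits (b : bitseq) : {set 'I_7} := [set i : 'I_7 | nth false b i].
Definition bits_of_set (B : {set 'I_7}) : bitseq := [seq i \in B | i <- enum 'I_7].

Lemma size_bits_of_set B : size (bits_of_set B) = 7.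
Proof. by rewrite size_map size_enum_ord. Qed.

Lemma bits_of_setK : cancel bits_of_set set_of_bits.
Proof.
move=> B; apply/setP => i; rewrite inE (nth_map i) ?size_enum_ord //.
by rewrite nth_ord_enum.
Qed.

Lemma set_of_bits_inj b c : size b = 7 -> size c = 7 ->
  set_of_bits b = set_of_bits c -> b = c.
Proof.
move=> sb sc /setP e; apply: (@eq_from_nth _ false); first by rewrite sc.
by rewrite sb => i i7; have := e (Ordinal i7); rewrite !inE.
Qed.

Lemma card_set_of_bits b : size b = 7 -> #|set_of_bits b| = count id b.
Proof.
move=> sb; rewrite -sum1dep_card -sum1_count (big_nth false) sb big_mkord.
exact: eq_bigl.
Qed.

Lemma mem_all_bits b : (b \in all_bits) = (size b == 7).
Proof.
rewrite /all_bits; elim: 7 b => [|n IH] [|x b] //=; rewrite mem_cat.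
  by apply/negbTE/norP; split; apply/mapP => -[].
rewrite eqSS -IH; apply/orP/idP => [[] /mapP[c cn [_ ->]] //|bn].
by case: x; [left|right]; apply: map_f.
Qed.

Lemma perm_all_bits : perm_eq (map set_of_bits all_bits) (enum {set 'I_7}).
Proof.
apply: uniq_perm; rewrite ?enum_uniq //.
  rewrite map_inj_in_uniq // => b c; rewrite !mem_all_bits => /eqP hb /eqP hc.
  exact: set_of_bits_inj.
move=> B; rewrite mem_enum -[B]bits_of_setK map_f //.
by rewrite mem_all_bits size_bits_of_set.
Qed.

Lemma size_bits_and b c : size b = 7 -> size c = 7 -> size (bits_and b c) = 7.
Proof. by move=> hb hc; rewrite size_map size_zip hb hc. Qed.

Lemma set_of_bits_and b c : size b = 7 -> size c = 7 ->
  set_of_bits (bits_and b c) = set_of_bits b :&: set_of_bits c.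
Proof.
move=> hb hc; apply/setP => i; rewrite !inE.
by rewrite (nth_map (false, false)) ?size_zip ?hb ?hc // nth_zip ?hb ?hc.
Qed.

Lemma bits_compatE b c : size b = 7 -> size c = 7 ->
  bits_compat b c = (#|set_of_bits b :&: set_of_bits c| <= 1).
Proof.
move=> hb hc; rewrite -set_of_bits_and // card_set_of_bits ?size_bits_and //.
(* The flag stands for a common point already met, hence counts as one. *)
have h seen x y : at_most_one_common seen x y = (seen + count id (bits_and x y) <= 1).
  elim: x y seen => [|u x IH] [|v y] seen //=; rewrite ?addn0; try by case: seen.
  by rewrite !IH; case: (u && v) => /=; rewrite ?add0n //; case: seen.
by rewrite /bits_compat h.
Qed.

Definition seq_perm (s : seq nat) : 'S_7 :=
  insubd (1%g : 'S_7) [ffun i : 'I_7 => inord (nth 0 s i) : 'I_7].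

Lemma seq_permE s i : perm_eq s (iota 0 7) -> seq_perm s i = nth 0 s i :> nat.
Proof.
move=> ps; have sz : size s = 7 by rewrite (perm_size ps) size_iota.
have lt7 (j : 'I_7) : nth 0 s j < 7.
  have : nth 0 s j \in s by rewrite mem_nth // sz.
  by rewrite (perm_mem ps) mem_iota.
have inj : injectiveb [ffun i : 'I_7 => inord (nth 0 s i) : 'I_7].
  apply/injectiveP => j k; rewrite !ffunE => /(congr1 val) /=.
  rewrite !inordK // => /eqP; rewrite nth_uniq ?sz ?(perm_uniq ps) ?iota_uniq //.
  by move/eqP/val_inj.
by rewrite -pvalE /seq_perm -[pval _]/(val _) val_insubd inj ffunE inordK.
Qed.

Lemma set_of_bits_act s b : perm_eq s (iota 0 7) ->
  set_of_bits (bits_act s b) = seq_perm s @^-1: set_of_bits b.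
Proof.
move=> ps; apply/setP => i; rewrite !inE seq_permE // (nth_map 0) //.
by rewrite (perm_size ps) size_iota.
Qed.

Definition small_orbits s := [seq o <- linear_orbits s | ~~ is_big o].

(** Certificate by evaluation: the computed orbits partition the blocks, are nonempty, closed under
    [s] and generated by each of their members, and the orbits of pairs are mutually compatible. *)
Definition orbits_ok (s : seq nat) : bool :=
  [&& perm_eq (flatten (block_orbits s)) all_blocks,
      all (fun o => (o != [::]) &&
        all (fun b => (bits_act s b \in o) &&
                      all (mem (traject (bits_act s) b (size o))) o) o) (block_orbits s) &
      all (fun o => all (fun o' => (o == o') || orbits_compat o o') (small_orbits s))
          (small_orbits s)].

Definition families_avoiding (s : 'S_7) (J : {set 'I_7}) : {set {set {set 'I_7}}} :=
  [set L in linear_families s | [disjoint cover L & J]].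

Definition set_compat (B C : {set 'I_7}) : bool := #|B :&: C| <= 1.

Lemma mem_all_blocks b : (b \in all_blocks) = (size b == 7) && (1 < count id b).
Proof.
rewrite -mem_all_bits; apply/flatten_mapP/andP => [[k kin]|[bb b1]].
  rewrite mem_filter => /andP[/eqP -> ->]; split=> //.
  by move: k kin; apply/allP.
exists (count id b); last by rewrite mem_filter eqxx.
move: bb; rewrite mem_all_bits => /eqP sb; have := count_size id b; rewrite sb.
by case: (count id b) b1 => [|[|[|[|[|[|[|[|]]]]]]]].
Qed.

Lemma mem_linear_orbits s o :
  (o \in linear_orbits s) = linear_orbit o && (o \in block_orbits s).
Proof. exact: mem_filter. Qed.

Lemma mem_small_orbits s o :
  (o \in small_orbits s) = ~~ is_big o && (o \in linear_orbits s).
Proof. exact: mem_filter. Qed.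

Lemma orbits_okP s : orbits_ok s -> [/\ perm_eq (flatten (block_orbits s)) all_blocks,
  forall o, o \in block_orbits s -> o != [::],
  forall o b, o \in block_orbits s -> b \in o ->
    (bits_act s b \in o) && all (mem (traject (bits_act s) b (size o))) o &
  forall o o', o \in small_orbits s -> o' \in small_orbits s ->
    (o == o') || orbits_compat o o'].
Proof.
case/and3P => h1 /allP h2 /allP h3; split=> //.
- by move=> o /h2/andP[].
- by move=> o b /h2/andP[_ /allP h]; apply: h.
by move=> o o' /h3/allP h; apply: h.
Qed.

Local Opaque orbits_ok small_orbits all_bits all_blocks block_orbits linear_orbits.

Section OrbitLists.
Variable s : seq nat.
Hypotheses (ps : perm_eq s (iota 0 7)) (ok : orbits_ok s).

Let perm_blocks : perm_eq (flatten (block_orbits s)) all_blocks.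
Proof. by case: (orbits_okP ok). Qed.

Lemma orbit_blocks o b : o \in block_orbits s -> b \in o -> size b = 7 /\ 1 < count id b.
Proof.
move=> os bo; have : b \in all_blocks.
  by rewrite -(perm_mem perm_blocks); apply/flattenP; exists o.
by rewrite mem_all_blocks => /andP[/eqP].
Qed.

Lemma orbit_closed o b : o \in block_orbits s -> b \in o -> bits_act s b \in o.
Proof.
by move=> os bo; have [_ _ h _] := orbits_okP ok; case/andP: (h o b os bo).
Qed.

Lemma orbit_transitive o b c : o \in block_orbits s -> b \in o -> c \in o ->
  exists n, c = iter n (bits_act s) b.
Proof.
move=> os bo co; have [_ _ h _] := orbits_okP ok; case/andP: (h o b os bo) => _.
by move=> /allP/(_ c co)/trajectP[n _ ->]; exists n.
Qed.

(** An invariant family is a union of orbits. Linearity inside an orbit is [linear_orbit], and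
    avoiding [J] can be tested orbit by orbit. The list [T] is fixed only up to order because it
    will be rearranged into big and small orbits. *)
Lemma families_avoidingE J (T : seq (seq bitseq)) : size J = 7 ->
  T =i [seq o <- linear_orbits s | misses J o] ->
  families_avoiding (seq_perm s) (set_of_bits J) =
  clique_unions set_compat (map (map set_of_bits) T).
Proof.
move=> sJ TE; have TP o : o \in T -> [/\ o \in block_orbits s, linear_orbit o & misses J o].
  by rewrite TE mem_filter mem_linear_orbits => /and3P[].
have missP b : size b = 7 -> ~~ has id (bits_and J b) = [disjoint set_of_bits b & set_of_bits J].
  move=> sb; rewrite has_count -card_set_of_bits ?size_bits_and // set_of_bits_and //.
  by rewrite -leqNgt leqn0 cards_eq0 setIC setI_eq0.
apply/setP => L; rewrite inE; apply/andP/clique_unionsP => [[/linear_familiesP[h1 h2 h3] dis]|].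
  have iterL n b : set_of_bits b \in L -> set_of_bits (iter n (bits_act s) b) \in L.
    by move=> bL; elim: n => //= n IH; rewrite set_of_bits_act // h3.
  have cov B : B \in L -> exists2 o, o \in T & exists2 b, b \in o & B = set_of_bits b.
    move=> BL; have sB := size_bits_of_set B; have cB := h1 B BL.
    have : bits_of_set B \in all_blocks.
      by rewrite mem_all_blocks sB -card_set_of_bits // bits_of_setK.
    rewrite -(perm_mem perm_blocks) => /flattenP[o os bo].
    have oL c : c \in o -> set_of_bits c \in L.
      move=> co; have [n ->] := orbit_transitive os bo co.
      by apply: iterL; rewrite bits_of_setK.
    exists o; last by exists (bits_of_set B); rewrite ?bits_of_setK.
    rewrite TE mem_filter mem_linear_orbits os andbT; apply/andP; split.
      apply/allP => c co; rewrite missP; last by case: (orbit_blocks os co).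
      apply: disjointWl dis; apply: (bigcup_sup (set_of_bits c)); exact: oL.
    apply/allP => c co; apply/allP => d do'; rewrite -implyNb; apply/implyP => cd.
    have [sc _] := orbit_blocks os co; have [sd _] := orbit_blocks os do'.
    rewrite bits_compatE //; apply: h2; rewrite ?oL //.
    by apply: contraNneq cd => /(set_of_bits_inj sc sd) ->.
  split.
  - move=> B /cov[o oT [b bo ->]]; rewrite -map_flatten map_f //.
    by apply/flattenP; exists o.
  - move=> _ B C /mapP[o /TP[os _ _] ->] /mapP[b bo ->] /mapP[c co ->] bL.
    by have [n ->] := orbit_transitive os bo co; apply: iterL.
  by move=> B C BL CL BC; apply: h2.
case=> h1 h2 h3.
have cov B : B \in L -> exists2 o, o \in T & exists2 b, b \in o & B = set_of_bits b.
  move=> /h1; rewrite -map_flatten => /mapP[b /flattenP[o oT bo] ->].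
  by exists o => //; exists b.
have closed (B : {set 'I_7}) : B \in L -> seq_perm s @^-1: B \in L.
  move=> BL; have [o oT [b bo e]] := cov B BL; have [os _ _] := TP o oT.
  rewrite e -set_of_bits_act //; apply: (h2 (map set_of_bits o) B); rewrite ?e ?map_f //.
    exact: orbit_closed.
  by rewrite -e.
split.
  apply/linear_familiesP; split=> // [B /cov[o /TP[os _ _] [b bo ->]]|B].
    by have [sb] := orbit_blocks os bo; rewrite card_set_of_bits.
  apply/idP/idP => [|]; last exact: closed.
  (* Taking preimages maps the finite family [L] injectively into itself, hence onto itself; this
     gives the converse implication. *)
  have e : [set seq_perm s @^-1: (C : {set 'I_7}) | C in L] = L.
    apply/eqP; rewrite eqEcard card_imset ?leqnn ?andbT; last exact: preimset_perm_inj.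
    by apply/subsetP => _ /imsetP[C CL ->]; apply: closed.
  by rewrite -{1}e => /imsetP[C CL /preimset_perm_inj ->].
apply/pred0P => i /=; apply/negP => /andP[/bigcupP[B /cov[o /TP[os _ /allP mJ] [b bo ->]] iB] iJ].
have [sb _] := orbit_blocks os bo.
by have := mJ b bo; rewrite missP // => /disjointFr/(_ iB); rewrite iJ.
Qed.

Lemma moments_avoidingP J : size J = 7 ->
  vrep (moments_avoiding (linear_orbits s) J)
    (fun j => \sum_(L in families_avoiding (seq_perm s) (set_of_bits J)) 'C(#|L|, j)).
Proof.
move=> sJ; rewrite /moments_avoiding; set os := filter _ _.
set big := filter _ os; set small := filter _ os.
have mem_os : big ++ small =i os.
  exact: perm_mem (permEl (perm_filterC is_big os)).
have osP o : o \in os -> [/\ o \in block_orbits s, linear_orbit o & misses J o].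
  by rewrite mem_filter mem_linear_orbits => /and3P[].
pose sized (o : seq bitseq) := all (fun b => size b == 7) o.
have all_sized o : o \in os -> sized o.
  by case/osP => bs _ _; apply/allP => b bo; case: (orbit_blocks bs bo) => ->.
rewrite (families_avoidingE sJ mem_os) map_cat.
have -> : clique_moments orbits_compat size (size os) big small =
    clique_moments (seqs_compat set_compat) size (size os)
      (map (map set_of_bits) big) (map (map set_of_bits) small).
  symmetry; apply: (clique_moments_map (p := sized)).
  - move=> o o' /allP so /allP so'; rewrite /seqs_compat /orbits_compat all_map.
    apply: eq_in_all => b /so/eqP sb; rewrite /= all_map; apply: eq_in_all => c /so'/eqP sc.
    by rewrite /= bits_compatE.
  - by move=> o _; rewrite size_map.
  - by apply/allP => o ob; apply: all_sized; rewrite -mem_os mem_cat ob.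
  - by apply/allP => o ob; apply: all_sized; rewrite -mem_os mem_cat ob orbT.
apply: clique_momentsP.
- by move=> B C; rewrite /set_compat setIC.
- by rewrite size_map size_filter count_size.
- rewrite -map_cat -map_flatten map_inj_in_uniq.
    have : perm_eq (flatten (big ++ small)) (flatten os).
      by apply: perm_flatten; rewrite perm_filterC.
    move/perm_uniq ->; apply: (subseq_uniq (subseq_flatten_filter _ _)).
    apply: (subseq_uniq (subseq_flatten_filter linear_orbit (block_orbits s))).
    by rewrite (perm_uniq perm_blocks).
  move=> b c /flattenP[o + bo] /flattenP[o' + co].
  rewrite !mem_os => /all_sized/allP/(_ b bo)/eqP sb /all_sized/allP/(_ c co)/eqP sc.
  exact: set_of_bits_inj.
- rewrite -map_cat => _ /mapP[o + ->]; rewrite mem_os => /[dup] /all_sized/allP so /osP[bs lo _].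
  split.
    by have [_ o0 _ _] := orbits_okP ok; move: (o0 o bs); case: (o).
  move=> _ _ /mapP[b bo ->] /mapP[c co ->] bc; rewrite /set_compat -bits_compatE; try exact/eqP/so.
  move/allP: lo => /(_ b bo)/allP/(_ c co)/orP[/eqP e|//].
  by rewrite e eqxx in bc.
move=> _ _ /mapP[o os1 ->] /mapP[o' os2 ->] oo'.
have sm x : x \in small -> x \in small_orbits s.
  by rewrite mem_small_orbits /small mem_filter /os mem_filter => /and3P[-> _].
have so : sized o by apply: all_sized; rewrite -mem_os mem_cat os1 orbT.
have so' : sized o' by apply: all_sized; rewrite -mem_os mem_cat os2 orbT.
have [_ _ _ sc] := orbits_okP ok; case/orP: (sc o o' (sm o os1) (sm o' os2)) => [/eqP e|].
  by rewrite e eqxx in oo'.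
move=> /allP h; apply/allP => _ /mapP[b bo ->]; apply/allP => _ /mapP[c co ->].
rewrite /set_compat -bits_compatE; last exact/eqP/(allP so').
  by move/allP: (h b bo); apply.
exact/eqP/(allP so).
Qed.

Lemma sum_bits_by_card k (G : {set 'I_7} -> nat) :
  \sum_(J <- [seq J <- all_bits | count id J == k]) G (set_of_bits J) =
  \sum_(J : {set 'I_7} | #|J| == k) G J.
Proof.
have <- : \sum_(J <- enum {set 'I_7} | #|J| == k) G J = \sum_(J : {set 'I_7} | #|J| == k) G J.
  by rewrite big_enum_cond; apply: eq_bigl.
rewrite big_filter -(perm_big _ perm_all_bits) big_map.
rewrite big_seq_cond [RHS]big_seq_cond; apply: eq_bigl => J.
have [|//] := boolP (J \in all_bits).
by rewrite mem_all_bits => /eqP sJ; rewrite card_set_of_bits.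
Qed.

Lemma moments_fam j d : j <= d -> j < 4 ->
  vnth (moments s d) j =
  \sum_(L in linear_families (seq_perm s)) 'C(family_weight L, j).
Proof.
move=> jd j4; rewrite /moments.
rewrite (@vrep_sum _ _ _ (fun k j => \sum_(J : {set 'I_7} | #|J| == k)
   (if k <= j then \sum_(L in families_avoiding (seq_perm s) J) 'C(#|L|, j - k) else 0))) //.
  (* Test sets of more than [j] points contribute nothing at order [j], so the sum up to [d] can be
     cut there. *)
  rewrite -[LHS]/(\sum_(0 <= k < d.+1) _) (big_cat_nat _ (n := j.+1)) //=.
  rewrite [X in _ + X]big_nat_cond [X in _ + X]big1 ?addn0 => [|k]; last first.
    by case/andP => /andP[jk _] _; rewrite big1 // => J _; rewrite leqNgt jk.
  rewrite big_mkord.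
  transitivity (\sum_(i < j.+1) \sum_(L in linear_families (seq_perm s))
      'C(#|~: cover L|, i) * 'C(#|L|, j - i)).
    apply: eq_bigr => i _; rewrite -ltnS ltn_ord.
    rewrite (exchange_big_dep (mem (linear_families (seq_perm s)))) /=; last first.
      by move=> J L _; rewrite inE => /andP[].
    (* For fixed [L], the test sets of size [i] that it avoids are the [i]-subsets of its uncovered
       points. *)
    apply: eq_bigr => L linL; rewrite -(cards_draws (~: cover L) i).
    rewrite -[X in _ = X * _]sum1_card big_distrl /=.
    apply: eq_big => [J|J _]; last by rewrite mul1n.
    rewrite [L \in families_avoiding _ _]inE linL /= inE andbC.
    by rewrite disjoint_sym disjoints_subset.
  rewrite exchange_big; apply: eq_bigr => L _.
  by rewrite binomial.Vandermonde /family_weight addnC.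
move=> k _; apply: vrep_ext => [i _|].
  by rewrite -(sum_bits_by_card k (fun J => if k <= i then
    \sum_(L in families_avoiding (seq_perm s) J) 'C(#|L|, i - k) else 0)).
apply: (@vrep_sum _ _ _ (fun J i => if k <= i then
  \sum_(L in families_avoiding (seq_perm s) (set_of_bits J)) 'C(#|L|, i - k) else 0)).
move=> J; rewrite mem_filter mem_all_bits => /andP[_ /eqP sJ].
exact: (@vrep_delay _ (fun i => \sum_(L in families_avoiding (seq_perm s) (set_of_bits J))
  'C(#|L|, i)) k (moments_avoidingP sJ)).
Qed.

End OrbitLists.

(** * Conjugacy classes *)

(** For positive parts, the denumerant of [ls]: the coefficient of z^t in the product of the series
    1/(1 - z^l). *)
Fixpoint coin_count (ls : seq nat) (t : nat) : nat :=
  if ls is l :: ls' then \sum_(k < t.+1 | k * l <= t) coin_count ls' (t - k * l)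
  else t == 0.

Lemma coin_count_widen l ls t n : 0 < l -> t < n ->
  coin_count (l :: ls) t = \sum_(k < n | k * l <= t) coin_count ls (t - k * l).
Proof.
move=> l0 tn; rewrite /= (big_ord_widen_cond n (fun k => k * l <= t)
  (fun k => coin_count ls (t - k * l))) //.
apply: eq_bigl => k; case: (leqP (k * l) t) => //= le.
by rewrite ltnS (leq_trans _ le) // leq_pmulr.
Qed.

(** Either the part [l] does not occur, or one copy of it can be removed. *)
Lemma coin_count_rec l ls t : 0 < l ->
  coin_count (l :: ls) t =
  coin_count ls t + (if l <= t then coin_count (l :: ls) (t - l) else 0).
Proof.
move=> l0; rewrite [in RHS](@coin_count_widen _ _ _ t.+1) ?ltnS ?leq_subr //.
rewrite (@coin_count_widen _ _ _ t.+2) // big_mkcond big_ord_recl /=.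
rewrite mul0n subn0; congr (_ + _); case: leqP => lt; last first.
  rewrite big1 // => k _; case: leqP => // le.
  by move: lt; rewrite ltnNge (leq_trans _ le) // leq_pmull.
rewrite [RHS]big_mkcond /=.
apply: eq_bigr => k _; rewrite /bump add1n mulSn leq_subRL // subnDA.
by rewrite (addnC l).
Qed.

(** Since the weights are positive and [t <= a], the bound [a] on the unknowns excludes no solution.
    The induction runs over the list of unknowns allowed to be nonzero. *)
Lemma card_coin_count (I : finType) (w : I -> nat) a t :
  (forall j, 0 < w j) -> t <= a ->
  #|[set k : {ffun I -> 'I_a.+1} | \sum_j w j * k j == t]| =
  coin_count (map w (enum I)) t.
Proof.
move=> w0; pose sols (js : seq I) t := [set k : {ffun I -> 'I_a.+1} |
  [forall j, (j \notin js) ==> (k j == ord0)] && (\sum_(j <- js) w j * k j == t)].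
suff main js : uniq js -> forall t, t <= a -> #|sols js t| = coin_count (map w js) t.
  move=> ta; rewrite -main ?enum_uniq //; apply: eq_card => k; rewrite !inE.
  rewrite big_enum; case: forallP => // -[j].
  by rewrite mem_enum.
elim: js => [_ {}t ta|j0 js IH /= /andP[j0js us] {}t ta].
  rewrite /= -[RHS]muln1 -(cards1 ([ffun=> ord0] : {ffun I -> 'I_a.+1})).
  case: eqP => [->|/eqP t0]; last first.
    rewrite mul0n; apply: eq_card0 => k; rewrite !inE big_nil eq_sym (negPf t0) andbF //.
  rewrite mul1n; apply: eq_card => k; rewrite !inE big_nil eqxx andbT.
  apply/forallP/eqP => [h|-> j]; last by rewrite ffunE.
  by apply/ffunP => j; rewrite ffunE; apply/eqP/h.
rewrite (big_ord_widen_cond a.+1 (fun k => k * w j0 <= t)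
  (fun k => coin_count (map w js) (t - k * w j0))) //.
rewrite -sum1_card (partition_big (fun k : {ffun I -> 'I_a.+1} => k j0) xpredT) //=.
rewrite [RHS]big_mkcond; apply: eq_bigr => v _.
pose upd (k : {ffun I -> 'I_a.+1}) := [ffun j => if j == j0 then v else k j].
have sumE (k : {ffun I -> 'I_a.+1}) :
    \sum_(j <- js) w j * upd k j = \sum_(j <- js) w j * k j.
  rewrite !big_seq; apply: eq_bigr => j jjs; rewrite ffunE; case: eqP => // e.
  by move: j0js; rewrite -e jjs.
have supp (k : {ffun I -> 'I_a.+1}) t' : k \in sols js t' -> k j0 = ord0.
  by rewrite inE => /andP[/forallP/(_ j0)]; rewrite j0js => /eqP.
have sub_sols k : k \in sols (j0 :: js) t -> k j0 = v ->
    v * w j0 <= t /\ exists2 k', k' \in sols js (t - v * w j0) & k = upd k'.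
  rewrite inE big_cons => /andP[/forallP h /eqP e] kv.
  rewrite -e kv mulnC leq_addr; split=> //; rewrite mulnC addKn.
  exists [ffun j => if j == j0 then ord0 else k j].
    rewrite inE; apply/andP; split.
      apply/forallP => j; apply/implyP => jjs; rewrite ffunE; case: (eqVneq j j0) => // jj0.
      by have := h j; rewrite inE (negPf jj0) (negPf jjs).
    apply/eqP; rewrite !big_seq; apply: eq_bigr => j jjs; rewrite ffunE; case: eqP => // e'.
    by move: j0js; rewrite -e' jjs.
  by apply/ffunP => j; rewrite !ffunE; case: eqP => // ->.
rewrite sum1dep_card; case: ifP => [/andP[le vt]|no]; last first.
  apply: eq_card0 => k; rewrite [LHS]inE; apply/negP => /andP[ks /eqP kv].
  have [le _] := sub_sols k ks kv; move: no; rewrite le ltnS (leq_trans _ le) //.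
  by rewrite leq_pmulr.
rewrite -IH ?(leq_trans (leq_subr _ _)) //.
rewrite -(card_in_imset (f := upd) (D := mem (sols js (t - v * w j0)))); last first.
  move=> k k' /supp k0 /supp k0' /ffunP e; apply/ffunP => j; have := e j; rewrite !ffunE.
  by case: eqP => // ->; rewrite k0 k0'.
apply: eq_card => k; rewrite [LHS]inE; apply/andP/imsetP => [[ks /eqP kv]|[k' ks' ->]].
  by have [_ [k' ks' ->]] := sub_sols k ks kv; exists k'.
rewrite ffunE eqxx; split=> //; move: ks'; rewrite !inE => /andP[/forallP h /eqP e].
apply/andP; split.
  apply/forallP => j; apply/implyP; rewrite inE negb_or => /andP[jj0 jjs].
  by rewrite ffunE (negPf jj0); have := h j; rewrite jjs.
by rewrite big_cons sumE e ffunE eqxx mulnC subnKC.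
Qed.

Definition cycle_ids (shape : seq nat) : seq nat :=
  flatten [seq nseq (nth 0 shape j) j | j <- iota 0 (size shape)].

(** Certificate for what [nb_fixed_sum] asks of the cycle numbering: invariance, transitivity on
    each cycle, and surjectivity through positive counts, together with the cycle lengths. Seven
    steps exhaust any cycle. *)
Definition ids_ok (s shape : seq nat) : bool :=
  let ids := cycle_ids shape in
  [&& size ids == 7, all (fun j => j < size shape) ids,
      all (fun i => nth 0 ids (nth 0 s i) == nth 0 ids i) (iota 0 7),
      all (fun i => all (fun j => (nth 0 ids i == nth 0 ids j) ==>
                                  (j \in traject (nth 0 s) i 7)) (iota 0 7)) (iota 0 7) &
      all (fun j => (0 < nth 0 shape j) && (count_mem j ids == nth 0 shape j))
          (iota 0 (size shape))].

Lemma nb_fixed_coin_count (s shape : seq nat) a :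
  perm_eq s (iota 0 7) -> ids_ok s shape ->
  nb_fixed a (seq_perm s) =
  \sum_(L in linear_families (seq_perm s))
    if family_weight L <= a then coin_count shape (a - family_weight L) else 0.
Proof.
move=> ps /and5P[/eqP sz /allP lt /allP inv /allP orb /allP cnt].
set ids := cycle_ids shape in sz lt inv orb cnt.
have mem7 (i : 'I_7) : (i : nat) \in iota 0 7 by rewrite mem_iota ltn_ord.
have lt' (i : 'I_7) : nth 0 ids i < size shape by apply: lt; rewrite mem_nth // sz.
pose idx (i : 'I_7) : 'I_(size shape) := Ordinal (lt' i).
have memj (j : 'I_(size shape)) : (j : nat) \in iota 0 (size shape).
  by rewrite mem_iota ltn_ord.
have idxE (j : 'I_(size shape)) : #|[set i | idx i == j]| = nth 0 shape j.
  have /andP[_ /eqP <-] := cnt j (memj j).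
  rewrite -sum1dep_card -sum1_count (big_nth 0) sz big_mkord.
  exact: eq_bigl.
have pos (j : 'I_(size shape)) : 0 < nth 0 shape j.
  by have /andP[] := cnt j (memj j).
rewrite (@nb_fixed_sum _ _ _ idx).
- apply: eq_bigr => L _; case: ifP => // le.
  rewrite /weighted_solutions (card_coin_count (w := fun j => #|[set i | idx i == j]|)).
  + congr coin_count; apply: (@eq_from_nth _ 0).
      by rewrite size_map size_enum_ord.
    rewrite size_map size_enum_ord => j jlt.
    by rewrite (nth_map (Ordinal jlt)) ?size_enum_ord // idxE nth_enum_ord.
  + by move=> j; rewrite idxE.
  exact: leq_subr.
- move=> j; have : 0 < #|[set i | idx i == j]| by rewrite idxE.
  by case/card_gt0P => i; rewrite inE; exists i.
- move=> i; apply/val_inj/eqP => /=; rewrite seq_permE //; exact: inv.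
move=> i j /(congr1 val) /= e.
have /allP/(_ _ (mem7 j)) := orb i (mem7 i); rewrite e eqxx => /trajectP[n _ en].
exists n; apply/val_inj; rewrite /= en.
elim: n {en} => //= n ->; by rewrite seq_permE.
Qed.

(** One-line notation of the permutation that rotates consecutive intervals of the given lengths,
    starting at [p]. *)
Fixpoint cycle_rep_from (p : nat) (shape : seq nat) : seq nat :=
  if shape is l :: ls then rcons (iota p.+1 l.-1) p ++ cycle_rep_from (p + l) ls
  else [::].

Definition cycle_rep : seq nat -> seq nat := cycle_rep_from 0.

(** Sorting by decreasing length makes the list of lengths a partition in the form used by
    [class_sizes]. *)
Definition point_cycles (s : seq nat) : seq (seq nat) :=
  sort (fun c d => size d <= size c)
    (foldl (fun cs i => if i \in flatten cs then cs
                        else rcons cs (undup (traject (nth 0 s) i 7)))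
           [::] (iota 0 7)).

Definition cycle_shape s := map size (point_cycles s).

(** The 15 partitions of 7. A class has 7!/z elements, where z is the product of i^m * m! over the
    parts i of multiplicity m; the values are confirmed below by counting over all permutations. *)
Definition class_sizes : seq (seq nat * nat) :=
  [:: ([:: 1; 1; 1; 1; 1; 1; 1], 1); ([:: 2; 1; 1; 1; 1; 1], 21);
      ([:: 2; 2; 1; 1; 1], 105); ([:: 3; 1; 1; 1; 1], 70);
      ([:: 2; 2; 2; 1], 105); ([:: 3; 2; 1; 1], 420); ([:: 4; 1; 1; 1], 210);
      ([:: 3; 2; 2], 210); ([:: 3; 3; 1], 280); ([:: 4; 2; 1], 630);
      ([:: 5; 1; 1], 504); ([:: 4; 3], 420); ([:: 5; 2], 504);
      ([:: 6; 1], 840); ([:: 7], 720)].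

Definition all_perms : seq (seq nat) := permutations (iota 0 7).

Lemma mem_all_perms s : (s \in all_perms) = perm_eq s (iota 0 7).
Proof. exact: mem_permutations. Qed.

Lemma size_all_perms : size all_perms = 7`!.
Proof. by rewrite size_permutations ?iota_uniq // size_iota. Qed.

Local Opaque all_perms factorial.

Lemma perm_seq_perm :
  perm_eq [seq seq_perm s | s <- all_perms] (enum 'S_7).
Proof.
pose seq_of (s : 'S_7) := [seq nat_of_ord (s i) | i <- enum 'I_7].
have seq_ofP s : seq_of s \in all_perms.
  rewrite mem_all_perms; apply: uniq_perm; rewrite ?iota_uniq //.
    by rewrite map_inj_uniq ?enum_uniq // => i j /val_inj /perm_inj.
  move=> k; rewrite mem_iota /=; apply/mapP/idP => [[i _ ->] //|k7].
  by exists ((s^-1)%g (Ordinal k7)); rewrite ?mem_enum // permKV.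
have seq_ofK : cancel seq_of seq_perm.
  move=> s; apply/permP => i; apply/val_inj => /=.
  rewrite seq_permE; last by rewrite -mem_all_perms.
  by rewrite (nth_map i) ?size_enum_ord // nth_ord_enum.
have u : uniq [seq seq_of s | s <- enum 'S_7].
  by rewrite map_inj_uniq ?enum_uniq //; apply: can_inj seq_ofK.
have p : perm_eq [seq seq_of s | s <- enum 'S_7] all_perms.
  apply: uniq_perm; [exact: u | exact: permutations_uniq |].
  have sub : {subset [seq seq_of s | s <- enum 'S_7] <= all_perms}.
    by move=> _ /mapP[s _ ->].
  (* The images are 7! distinct members of a list of length 7!, so they are all of it. *)
  apply: (uniq_min_size u sub _).2.
  by rewrite size_all_perms size_map -cardE card_Sn.
rewrite perm_sym -[X in perm_eq X](mapK seq_ofK); exact: perm_map.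
Qed.

Lemma sum_by_class (T : eqType) (xs : seq T) (table : seq (T * nat)) (G : T -> nat) :
  uniq (map fst table) -> {subset xs <= map fst table} ->
  {in table, forall p, count_mem p.1 xs = p.2} ->
  \sum_(x <- xs) G x = \sum_(p <- table) p.2 * G p.1.
Proof.
move=> u sub cnt.
transitivity (\sum_(x <- xs) \sum_(l <- map fst table | l == x) G l).
  rewrite !big_seq; apply: eq_bigr => x /sub xl; rewrite -big_filter.
  by rewrite (filter_pred1_uniq u xl) big_seq1.
rewrite (exchange_big_dep xpredT) //= big_map big_seq [RHS]big_seq; apply: eq_bigr => p pt.
rewrite big_const_seq iter_addn_0 mulnC -cnt //; congr (_ * _).
by apply: eq_count => x; rewrite /= eq_sym.
Qed.

(** Writing the cycles of [s] one after another gives a permutation [g] that carries the intervals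
    rotated by [r] to these cycles. The tested identity says that [s] after [g] equals [g] after
    [r], so [g] conjugates one to the other. *)
Definition conjugacy_ok : bool :=
  all (fun s => let g := flatten (point_cycles s) in let r := cycle_rep (cycle_shape s) in
    [&& perm_eq g (iota 0 7), perm_eq r (iota 0 7) &
        [seq nth 0 s i | i <- g] == [seq nth 0 g i | i <- r]])
    (all_perms).

Definition class_sizes_ok : bool :=
  let xs := map cycle_shape (all_perms) in
  all (mem (map fst class_sizes)) xs &&
  all (fun p => count_mem p.1 xs == p.2) class_sizes.

Lemma conjugacy_okT : conjugacy_ok.
Proof. by vm_compute. Qed.

Lemma class_sizes_okT : class_sizes_ok.
Proof. by vm_compute. Qed.

Lemma conj_cycle_rep s : perm_eq s (iota 0 7) ->
  exists g, seq_perm s = (seq_perm (cycle_rep (cycle_shape s)) ^ g)%g.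
Proof.
rewrite -mem_all_perms => ps; have := ps; rewrite mem_all_perms => ps'.
have /and3P[pg pr /eqP e] := allP conjugacy_okT s ps.
set g := flatten _ in pg e; set r := cycle_rep _ in pr e *.
exists (seq_perm g); rewrite conjgE; apply: (mulgI (seq_perm g)); rewrite mulKVg.
apply/permP => i; apply/val_inj; rewrite !permM /= !seq_permE //.
have sg : size g = 7 by rewrite (perm_size pg) size_iota.
have sr : size r = 7 by rewrite (perm_size pr) size_iota.
have := congr1 (fun t => nth 0 t i) e.
by rewrite !(nth_map 0) ?sg ?sr.
Qed.

Lemma sum_class_function (F : 'S_7 -> nat) :
  (forall s g, F (s ^ g)%g = F s) ->
  \sum_(s : 'S_7) F s =
  \sum_(p <- class_sizes) p.2 * F (seq_perm (cycle_rep p.1)).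
Proof.
move=> Fconj; have -> : \sum_(s : 'S_7) F s = \sum_(s <- enum 'S_7) F s.
  by rewrite big_enum; apply: eq_bigl.
rewrite -(perm_big _ perm_seq_perm) big_map.
transitivity (\sum_(x <- map cycle_shape (all_perms))
    F (seq_perm (cycle_rep x))).
  rewrite big_map big_seq [RHS]big_seq; apply: eq_bigr => s.
  by rewrite mem_all_perms => /conj_cycle_rep[g ->]; rewrite Fconj.
case/andP: class_sizes_okT => /allP sub /allP cnt.
apply: (sum_by_class (fun x => F (seq_perm (cycle_rep x)))) => //.
by move=> p /cnt/eqP.
Qed.

Lemma burnside_7 a :
  nb_rank3_lattices 7 a * 5040 =
  \sum_(p <- class_sizes) p.2 * nb_fixed a (seq_perm (cycle_rep p.1)).
Proof.
rewrite -sum_class_function => [|s g]; last exact: nb_fixed_conj.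
have := burnside_rank3 a (ord0 : 'I_7); rewrite card_Sn card_ord => ->.
by congr (_ * _).
Qed.

Definition cycle_reps_ok : bool :=
  all (fun p => perm_eq (cycle_rep p.1) (iota 0 7) && ids_ok (cycle_rep p.1) p.1)
    class_sizes.

Lemma cycle_reps_okT : cycle_reps_ok.
Proof. by vm_compute. Qed.

Definition vec_eqb (u v : vec) : bool :=
  let: (u0, u1, u2, u3) := u in let: (v0, v1, v2, v3) := v in
  [&& N.eqb u0 v0, N.eqb u1 v1, N.eqb u2 v2 & N.eqb u3 v3].

Lemma vec_eqbP (u v : vec) : vec_eqb u v -> u = v.
Proof.
case: u v => [[[u0 u1] u2] u3] [[[v0 v1] v2] v3] /and4P[].
by do 4! move=> /N.eqb_eq ->.
Qed.

(** * Asymptotics *)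

From mathcomp Require Import ring lra.
Import Order.TTheory GRing.Theory Num.Theory.
Local Open Scope ring_scope.

Section Asymptotics.
Variable R : realFieldType.

(** The index is shifted by one so that [growth_le 0] means exact equality to zero; [t.+1] keeps the
    other bounds positive at [t = 0]. *)
Definition growth (d t : nat) : R := if d is e.+1 then t.+1%:R ^+ e else 0.

Definition growth_le (d : nat) (f : nat -> R) : Prop :=
  exists B, forall t, `|f t| <= B * growth d t.

Lemma growth_ge0 d t : 0 <= growth d t.
Proof. by case: d => //= d; rewrite exprn_ge0. Qed.

Lemma growth_mono d t u : (t <= u)%N -> growth d t <= growth d u.
Proof.
case: d => [|d] tu; rewrite /growth //.
by apply: lerXn2r; rewrite ?nnegrE ?ler0n // ler_nat ltnS.
Qed.

Lemma growthS_ge1 d t : 1 <= growth d.+1 t.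
Proof. by rewrite /= exprn_ege1 // ler1n. Qed.

Lemma growth_step d t : t.+1%:R * growth d t <= growth d.+1 t.
Proof. by case: d => [|d]; rewrite /= ?mulr0 // -exprS. Qed.

Lemma growth_leW d e f : (d <= e)%N -> growth_le d f -> growth_le e f.
Proof.
move=> de [B h]; exists `|B| => t; apply: le_trans (h t) _.
have [g0 g1] : 0 <= growth d t /\ growth d t <= growth e t.
  split; first exact: growth_ge0.
  case: d e de {h} => [|d] [|e] //= de; first exact: exprn_ge0.
  by rewrite ler_weXn2l // ler1n.
apply: le_trans (ler_wpM2r g0 (ler_norm B)) _.
exact: ler_wpM2l.
Qed.

(* Telescoping over the steps of size [l]: the errors of [coin_count ls] at
   [t], [t - l], ... add up, which costs one power of [t]; when [d = 0] only the
   finitely many initial values contribute. *)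
Lemma growth_le_step d l ls (p q : R -> R) : (0 < l)%N ->
  growth_le d (fun t => (coin_count ls t)%:R - q t%:R) ->
  (forall x, p x - p (x - l%:R) = q x) ->
  growth_le d.+1 (fun t => (coin_count (l :: ls) t)%:R - p t%:R).
Proof.
move=> l0 [B0 hB] pq; set F := coin_count (l :: ls).
pose B := `|B0|; have B_ge0 : 0 <= B by apply: normr_ge0.
have {}hB t : `|(coin_count ls t)%:R - q t%:R| <= B * growth d t.
  by apply: le_trans (hB t) _; rewrite ler_wpM2r ?growth_ge0 // ler_norm.
pose D := \sum_(i < l) `|(F i)%:R - p i%:R|.
have D0 : 0 <= D by apply: sumr_ge0.
have main t : `|(F t)%:R - p t%:R| <= D + B * (t.+1%:R * growth d t).
  elim/ltn_ind: t => t IH; rewrite /F coin_count_rec // -/F.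
  have Bg u : 0 <= B * (u.+1%:R * growth d u).
    by rewrite !mulr_ge0 ?growth_ge0.
  case: leqP => lt; last first.
    apply: (@le_trans _ _ D); last by rewrite lerDl.
    rewrite /D (bigD1 (Ordinal lt)) //=.
    have -> : F t = (coin_count ls t + 0)%N by rewrite /F coin_count_rec // leqNgt lt.
    by rewrite lerDl sumr_ge0.
  have tl : (t - l < t)%N by rewrite ltn_subrL l0 (leq_trans l0).
  have -> : (coin_count ls t + F (t - l))%N%:R - p t%:R =
    ((coin_count ls t)%:R - q t%:R) + ((F (t - l)%N)%:R - p (t - l)%N%:R).
    by rewrite -pq natrD natrB //; ring.
  apply: le_trans (ler_normD _ _) _; apply: le_trans (lerD (hB t) (IH _ tl)) _.
  rewrite addrCA lerD2l -mulrDr ler_wpM2l //.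
  apply: (@le_trans _ _ (growth d t + t%:R * growth d t)).
    rewrite lerD2l ler_pM ?growth_ge0 ?ler_nat ?growth_mono //.
    exact: leq_subr.
  by rewrite -[X in X + _]mul1r -mulrDl -natr1 addrC.
exists (D + B) => t; apply: le_trans (main t) _; rewrite mulrDl lerD //.
  by rewrite ler_peMr ?growthS_ge1.
by rewrite ler_wpM2l ?growth_step.
Qed.

(** For steps of size one the only initial value is at 0, and [p (- 1) = 0] makes it correct, so
    exactness is preserved. *)
Lemma coin_count1_exact ls (p q : R -> R) :
  growth_le 0 (fun t => (coin_count ls t)%:R - q t%:R) ->
  (forall x, p x - p (x - 1) = q x) -> p (- 1) = 0 ->
  growth_le 0 (fun t => (coin_count (1%N :: ls) t)%:R - p t%:R).
Proof.
move=> [B hB] pq p1; have {hB} e t : (coin_count ls t)%:R = q t%:R.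
  by apply/eqP; rewrite -subr_eq0 -normr_le0; have := hB t; rewrite mulr0.
exists 0 => t; rewrite mul0r normr_le0 subr_eq0; apply/eqP.
elim: t => [|t IH]; rewrite coin_count_rec //.
  by rewrite addn0 e -pq mulr0n sub0r p1 subr0.
rewrite subn1 natrD /= IH e -pq.
by have -> : t.+1%:R - 1 = t%:R :> R by [rewrite -natr1 addrK]; rewrite subrK.
Qed.

Lemma coin_count_single l : (0 < l)%N ->
  growth_le 1 (fun t => (coin_count [:: l] t)%:R).
Proof.
move=> l0; exists 1 => t; have -> : growth 1 t = 1 by rewrite /growth expr0.
rewrite mulr1 ger0_norm ?ler0n // lern1.
elim/ltn_ind: t => t IH; rewrite coin_count_rec //.
case: t IH => [|t] IH; first by rewrite [(l <= 0)%N]leqNgt l0.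
have -> : coin_count [::] t.+1 = 0%N by [].
rewrite add0n; case: (leqP l t.+1) => // lt; apply: IH.
by rewrite ltn_subrL l0.
Qed.

Definition peval (c : seq R) (x : R) : R := foldr (fun u v => u + x * v) 0 c.

Definition approx2 (f g : nat -> R) : Prop :=
  exists B n0, forall a, (n0 <= a)%N -> `|f a - g a| <= B * a%:R ^+ 2.

Lemma approx2_trans f g h : approx2 f g -> approx2 g h -> approx2 f h.
Proof.
move=> [B [n hB]] [C [m hC]]; exists (B + C), (maxn n m) => a.
rewrite geq_max => /andP[/hB h1 /hC h2].
have -> : f a - h a = (f a - g a) + (g a - h a) by ring.
by rewrite mulrDl (le_trans (ler_normD _ _)) // lerD.
Qed.

Lemma approx2D f g f' g' : approx2 f g -> approx2 f' g' ->
  approx2 (fun a => f a + f' a) (fun a => g a + g' a).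
Proof.
move=> [B [n hB]] [C [m hC]]; exists (B + C), (maxn n m) => a.
rewrite geq_max => /andP[/hB h1 /hC h2].
have -> : f a + f' a - (g a + g' a) = (f a - g a) + (f' a - g' a) by ring.
by rewrite mulrDl (le_trans (ler_normD _ _)) // lerD.
Qed.

Lemma approx2Z c f g : approx2 f g -> approx2 (fun a => c * f a) (fun a => c * g a).
Proof.
move=> [B [n hB]]; exists (`|c| * B), n => a /hB h.
by rewrite -mulrBr normrM -mulrA ler_wpM2l.
Qed.

Lemma approx2_sum (X : Type) (r : seq X) (P : pred X) (f g : X -> nat -> R) :
  (forall x, P x -> approx2 (f x) (g x)) ->
  approx2 (fun a => \sum_(x <- r | P x) f x a) (fun a => \sum_(x <- r | P x) g x a).
Proof.
move=> h; elim: r => [|x r [B [n hB]]].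
  by exists 0, 0%N => a _; rewrite !big_nil subrr normr0 mul0r.
have [Px|nPx] := boolP (P x); last first.
  by exists B, n => a /hB; rewrite !big_cons (negPf nPx).
have [C [m hC]] := h x Px; exists (C + B), (maxn m n) => a.
rewrite geq_max => /andP[/hC h1 /hB h2]; rewrite !big_cons Px.
rewrite opprD addrACA mulrDl (le_trans (ler_normD _ _)) // lerD //.
Qed.

(* The terms of degree at least 3 in [x] of [c_0 + ... + c_6 (x - w) ^ 6], with
   [1, w, w ^ 2, w ^ 3] replaced by their sums [q0, ..., q3]. *)
Definition top_terms (c : nat -> R) (q0 q1 q2 q3 : R) (x : R) : R :=
  c 6%N * q0 * x ^+ 6 + (c 5%N * q0 - 6%:R * c 6%N * q1) * x ^+ 5
  + (c 4%N * q0 - 5%:R * c 5%N * q1 + 15%:R * c 6%N * q2) * x ^+ 4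
  + (c 3%N * q0 - 4%:R * c 4%N * q1 + 10%:R * c 5%N * q2 - 20%:R * c 6%N * q3) * x ^+ 3.

Lemma quadratic_le (u v w x : R) : 1 <= x ->
  `|u * x ^+ 2 + v * x + w| <= (`|u| + `|v| + `|w|) * x ^+ 2.
Proof.
move=> x1; have x0 : 0 <= x by apply: le_trans x1.
have x2 : x <= x ^+ 2 by rewrite expr2 ler_peMr.
apply: le_trans (ler_normD _ _) _; rewrite !mulrDl; apply: lerD.
  apply: le_trans (ler_normD _ _) _; rewrite !normrM !(ger0_norm x0).
  by rewrite -expr2 lerD // ler_wpM2l.
by rewrite ler_peMr // (le_trans x1).
Qed.

Lemma peval_shift_approx2 (c : seq R) (s : R) : size c = 7%N ->
  approx2 (fun a => peval c (a%:R - s))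
          (fun a => top_terms (nth 0 c) 1 s (s ^+ 2) (s ^+ 3) a%:R).
Proof.
case: c => [|c0 [|c1 [|c2 [|c3 [|c4 [|c5 [|c6 [|//]]]]]]]] // _.
(* The next three terms are the coefficients of degrees 2, 1 and 0 of the polynomial shifted by
   [s]. *)
pose u := c2 - 3%:R * c3 * s + 6%:R * c4 * s ^+ 2 - 10%:R * c5 * s ^+ 3 + 15%:R * c6 * s ^+ 4.
pose v := c1 - 2%:R * c2 * s + 3%:R * c3 * s ^+ 2 - 4%:R * c4 * s ^+ 3
   + 5%:R * c5 * s ^+ 4 - 6%:R * c6 * s ^+ 5.
pose w := c0 - c1 * s + c2 * s ^+ 2 - c3 * s ^+ 3 + c4 * s ^+ 4 - c5 * s ^+ 5 + c6 * s ^+ 6.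
exists (`|u| + `|v| + `|w|), 1%N => a a1.
have -> : peval [:: c0; c1; c2; c3; c4; c5; c6] (a%:R - s)
   - top_terms (nth 0 [:: c0; c1; c2; c3; c4; c5; c6]) 1 s (s ^+ 2) (s ^+ 3) a%:R =
   u * a%:R ^+ 2 + v * a%:R + w.
  by rewrite /peval /top_terms /u /v /w /=; ring.
by apply: quadratic_le; rewrite ler1n.
Qed.

Lemma coin_count_approx2 shape (c : seq R) s : size c = 7%N ->
  growth_le 3 (fun t => (coin_count shape t)%:R - peval c t%:R) ->
  approx2 (fun a => (if (s <= a)%N then coin_count shape (a - s) else 0%N)%:R)
          (fun a => top_terms (nth 0 c) 1 s%:R (s%:R ^+ 2) (s%:R ^+ 3) a%:R).
Proof.
move=> sc [B hB]; apply: approx2_trans (peval_shift_approx2 s%:R sc).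
(* The factor 4 comes from (a - s + 1)^2 <= (2a)^2, valid once a > s. *)
exists (`|B| * 4%:R), s.+1 => a sa; rewrite (ltnW sa).
have -> : a%:R - s%:R = (a - s)%N%:R :> R by rewrite natrB // ltnW.
apply: le_trans (hB _) _; rewrite -mulrA.
apply: le_trans (ler_wpM2r (growth_ge0 _ _) (ler_norm B)) _; rewrite ler_wpM2l //=.
rewrite -!natrX -natrM ler_nat -(expnMn 2 a 2) leq_exp2r //.
by rewrite mul2n -addnn -addn1 leq_add ?leq_subr // (leq_trans _ sa).
Qed.

Lemma sum_top_terms (X : Type) (r : seq X) (P : pred X) c (f0 f1 f2 f3 : X -> R) x :
  \sum_(i <- r | P i) top_terms c (f0 i) (f1 i) (f2 i) (f3 i) x =
  top_terms c (\sum_(i <- r | P i) f0 i) (\sum_(i <- r | P i) f1 i)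
              (\sum_(i <- r | P i) f2 i) (\sum_(i <- r | P i) f3 i) x.
Proof.
elim: r => [|i r IH]; first by rewrite !big_nil /top_terms; ring.
by rewrite !big_cons; case: (P i); rewrite IH // /top_terms; ring.
Qed.

(** This and the next identity write powers in the binomial basis; the coefficients are j! times
    Stirling numbers of the second kind. *)
Lemma sqr_binomial n : n%:R ^+ 2 = 2%:R * 'C(n, 2)%:R + 'C(n, 1)%:R :> R.
Proof.
elim: n => [|n IH]; first by rewrite expr0n mulr0 addr0.
by rewrite -natr1 !binS bin0 !natrD sqrrD IH bin1; ring.
Qed.

Lemma cube_binomial n :
  n%:R ^+ 3 = 6%:R * 'C(n, 3)%:R + 6%:R * 'C(n, 2)%:R + 'C(n, 1)%:R :> R.
Proof.
elim: n => [|n IH]; first by rewrite expr0n !mulr0 !addr0.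
have -> : n.+1%:R ^+ 3 = n%:R ^+ 3 + 3%:R * n%:R ^+ 2 + 3%:R * n%:R + 1 :> R.
  by rewrite -natr1; ring.
by rewrite IH sqr_binomial !binS bin0 bin1 !natrD; ring.
Qed.

Definition moment_sum (s : 'S_7) (j : nat) : nat :=
  \sum_(L in linear_families s) 'C(family_weight L, j).

Definition binomial_top_terms (c : seq R) (m0 m1 m2 m3 : R) : R -> R :=
  top_terms (nth 0 c) m0 m1 (2%:R * m2 + m1) (6%:R * m3 + 6%:R * m2 + m1).

Lemma nb_fixed_approx2 shape (c : seq R) :
  let s := cycle_rep shape in let m j := (moment_sum (seq_perm s) j)%:R in
  perm_eq s (iota 0 7) -> ids_ok s shape -> size c = 7%N ->
  growth_le 3 (fun t => (coin_count shape t)%:R - peval c t%:R) ->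
  approx2 (fun a => (nb_fixed a (seq_perm s))%:R)
          (fun a => binomial_top_terms c (m 0%N) (m 1%N) (m 2%N) (m 3%N) a%:R).
Proof.
move=> s m ps ids sc gr.
have [B [n h]] := approx2_sum (index_enum _)
  (fun L (_ : L \in linear_families (seq_perm s)) => coin_count_approx2 (family_weight L) sc gr).
exists B, n => a /h {h}; rewrite (nb_fixed_coin_count _ ps ids) natr_sum sum_top_terms.
suff -> : top_terms (nth 0 c) (\sum_(L in linear_families (seq_perm s)) 1)
    (\sum_(L in linear_families (seq_perm s)) (family_weight L)%:R)
    (\sum_(L in linear_families (seq_perm s)) (family_weight L)%:R ^+ 2)
    (\sum_(L in linear_families (seq_perm s)) (family_weight L)%:R ^+ 3) a%:R =
  binomial_top_terms c (m 0%N) (m 1%N) (m 2%N) (m 3%N) a%:R by [].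
rewrite /binomial_top_terms /m /moment_sum !natr_sum !mulr_sumr -!big_split /=.
congr (top_terms _ _ _ _ _ _); apply: eq_bigr => L _.
- by rewrite bin0.
- by rewrite bin1.
- exact: sqr_binomial.
exact: cube_binomial.
Qed.

Definition natN (v : N) : R := (N.to_nat v)%:R.

(* The vector is exact up to order [d] only, but [c] has degree at most [d + 3],
   so its other entries are multiplied by zero. *)
Lemma class_approx2 shape d v0 v1 v2 v3 (c : seq R) :
  orbits_ok (cycle_rep shape) && vec_eqb (moments (cycle_rep shape) d) (v0, v1, v2, v3) ->
  shape \in map fst class_sizes -> (d < 4)%N -> size c = 7%N ->
  (forall i, (d + 3 < i < 7)%N -> nth 0 c i = 0) ->
  growth_le 3 (fun t => (coin_count shape t)%:R - peval c t%:R) ->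
  approx2 (fun a => (nb_fixed a (seq_perm (cycle_rep shape)))%:R)
    (fun a => binomial_top_terms c (natN v0) (natN v1) (natN v2) (natN v3) a%:R).
Proof.
move=> /andP[ok /vec_eqbP ev] /mapP[[shape' n] sn /= e] d4 sc c0 gr; subst shape'.
have /andP[ps ids] := allP cycle_reps_okT _ sn.
have mE j : (j <= d)%N -> moment_sum (seq_perm (cycle_rep shape)) j =
    vnth (v0, v1, v2, v3) j.
  by move=> jd; rewrite -ev (moments_fam ps ok jd) // (leq_ltn_trans jd).
have := nb_fixed_approx2 ps ids sc gr; set f := (X in approx2 X _).
move=> [B [m h]]; exists B, m => a /h {h}; congr (_ <= _); congr `|_ - _|.
rewrite /binomial_top_terms /top_terms.
have z := fun i h => c0 i h; rewrite (mE 0%N) //.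
case: d d4 mE z {c0 ev} => [|[|[|[|//]]]] _ mE z; rewrite /natN.
- by rewrite (z 4%N) // (z 5%N) // (z 6%N) //; ring.
- by rewrite (mE 1%N) // (z 5%N) // (z 6%N) //; ring.
- by rewrite (mE 1%N) // (mE 2%N) // (z 6%N) //; ring.
by rewrite (mE 1%N) // (mE 2%N) // (mE 3%N).
Qed.
End Asymptotics.

(** * Polynomial approximations and moments for each cycle type *)

Section CycleShapes.
Variable R : realFieldType.

Definition shape_error (shape : seq nat) (c : seq R) (t : nat) : R :=
  (coin_count shape t)%:R - peval c t%:R.

(* [ones_k] interpolates binomial(t + k - 1, k - 1); the other polynomials solve
   p(x) - p(x - l) = q(x), where q belongs to the shape without its first part l,
   with the arbitrary choice p(0) = 0. *)
Definition ones3 : seq R := [:: 1; 3%:R / 2%:R; 1 / 2%:R; 0; 0; 0; 0].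
Definition ones4 : seq R := [:: 1; 11%:R / 6%:R; 1; 1 / 6%:R; 0; 0; 0].
Definition ones5 : seq R := [:: 1; 25%:R / 12%:R; 35%:R / 24%:R; 5%:R / 12%:R; 1 / 24%:R; 0; 0].
Definition ones6 : seq R :=
  [:: 1; 137%:R / 60%:R; 15%:R / 8%:R; 17%:R / 24%:R; 1 / 8%:R; 1 / 120%:R; 0].
Definition ones7 : seq R :=
  [:: 1; 49%:R / 20%:R; 203%:R / 90%:R; 49%:R / 48%:R; 35%:R / 144%:R; 7%:R / 240%:R; 1 / 720%:R].
Definition two_ones5 : seq R :=
  [:: 0; 121%:R / 60%:R; 35%:R / 24%:R; 23%:R / 48%:R; 7%:R / 96%:R; 1 / 240%:R; 0].
Definition twos2_ones3 : seq R :=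
  [:: 0; 11%:R / 12%:R; 17%:R / 24%:R; 7%:R / 48%:R; 1 / 96%:R; 0; 0].
Definition three_ones4 : seq R :=
  [:: 0; 7%:R / 4%:R; 67%:R / 72%:R; 7%:R / 36%:R; 1 / 72%:R; 0; 0].
Definition twos3_one : seq R := [:: 0; 1 / 6%:R; 1 / 8%:R; 1 / 48%:R; 0; 0; 0].
Definition three_two_ones2 : seq R := [:: 0; 5%:R / 8%:R; 7%:R / 24%:R; 1 / 36%:R; 0; 0; 0].
Definition four_ones3 : seq R := [:: 0; 4%:R / 3%:R; 7%:R / 16%:R; 1 / 24%:R; 0; 0; 0].

Lemma error_ones1 : growth_le 0 (shape_error [:: 1%N] [:: 1; 0; 0; 0; 0; 0; 0]).
Proof.
exists 0 => t; rewrite mul0r normr_le0 /shape_error; have -> : coin_count [:: 1%N] t = 1%N.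
  elim: t => [|t IH]; rewrite coin_count_rec //.
  by rewrite subn1 [(t.+1).-1]/= IH.
by apply/eqP; rewrite /peval /=; ring.
Qed.

Lemma error_ones2 : growth_le 0 (shape_error [:: 1; 1]%N [:: 1; 1; 0; 0; 0; 0; 0]).
Proof.
by apply: coin_count1_exact error_ones1 _ _ => [x|]; rewrite /peval /=; ring.
Qed.

Lemma error_ones3 : growth_le 0 (shape_error [:: 1; 1; 1]%N ones3).
Proof.
by apply: coin_count1_exact error_ones2 _ _ => [x|]; rewrite /peval /=; field.
Qed.

Lemma error_ones4 : growth_le 0 (shape_error [:: 1; 1; 1; 1]%N ones4).
Proof.
by apply: coin_count1_exact error_ones3 _ _ => [x|]; rewrite /peval /=; field.
Qed.

Lemma error_ones5 : growth_le 0 (shape_error [:: 1; 1; 1; 1; 1]%N ones5).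
Proof.
by apply: coin_count1_exact error_ones4 _ _ => [x|]; rewrite /peval /=; field.
Qed.

Lemma error_ones6 : growth_le 0 (shape_error [:: 1; 1; 1; 1; 1; 1]%N ones6).
Proof.
by apply: coin_count1_exact error_ones5 _ _ => [x|]; rewrite /peval /=; field.
Qed.

Lemma error_ones7 : growth_le 0 (shape_error [:: 1; 1; 1; 1; 1; 1; 1]%N ones7).
Proof.
by apply: coin_count1_exact error_ones6 _ _ => [x|]; rewrite /peval /=; field.
Qed.

Lemma error_two_ones5 : growth_le 1 (shape_error [:: 2; 1; 1; 1; 1; 1]%N two_ones5).
Proof.
by apply: growth_le_step error_ones5 _ => // x; rewrite /peval /=; field.
Qed.

Lemma error_twos2_ones3 : growth_le 2 (shape_error [:: 2; 2; 1; 1; 1]%N twos2_ones3).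
Proof.
have h : growth_le 1 (shape_error [:: 2; 1; 1; 1]%N
    [:: 0; 17%:R / 12%:R; 5%:R / 8%:R; 1 / 12%:R; 0; 0; 0]).
  by apply: growth_le_step error_ones3 _ => // x; rewrite /peval /=; field.
by apply: growth_le_step h _ => // x; rewrite /peval /=; field.
Qed.

Lemma error_three_ones4 : growth_le 1 (shape_error [:: 3; 1; 1; 1; 1]%N three_ones4).
Proof.
by apply: growth_le_step error_ones4 _ => // x; rewrite /peval /=; field.
Qed.

Lemma error_twos3_one : growth_le 3 (shape_error [:: 2; 2; 2; 1]%N twos3_one).
Proof.
have h1 : growth_le 1 (shape_error [:: 2; 1]%N [:: 0; 1 / 2%:R; 0; 0; 0; 0; 0]).
  by apply: growth_le_step error_ones1 _ => // x; rewrite /peval /=; field.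
have h2 : growth_le 2 (shape_error [:: 2; 2; 1]%N [:: 0; 1 / 4%:R; 1 / 8%:R; 0; 0; 0; 0]).
  by apply: growth_le_step h1 _ => // x; rewrite /peval /=; field.
by apply: growth_le_step h2 _ => // x; rewrite /peval /=; field.
Qed.

Lemma error_three_two_ones2 : growth_le 2 (shape_error [:: 3; 2; 1; 1]%N three_two_ones2).
Proof.
have h : growth_le 1 (shape_error [:: 2; 1; 1]%N [:: 0; 1; 1 / 4%:R; 0; 0; 0; 0]).
  by apply: growth_le_step error_ones2 _ => // x; rewrite /peval /=; field.
by apply: growth_le_step h _ => // x; rewrite /peval /=; field.
Qed.

Lemma error_four_ones3 : growth_le 1 (shape_error [:: 4; 1; 1; 1]%N four_ones3).
Proof.
by apply: growth_le_step error_ones3 _ => // x; rewrite /peval /=; field.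
Qed.

(** A single part gives a bounded count, and each further part costs one power of [t] by
    [growth_le_step] with zero polynomials; three parts give at most order [t ^ 2]. *)
Lemma few_cycles_growth shape : (0 < size shape <= 3)%N -> all (ltn 0) shape ->
  growth_le 3 (fun t => (coin_count shape t)%:R : R).
Proof.
have step d l ls : (0 < l)%N -> growth_le d (fun t => (coin_count ls t)%:R : R) ->
    growth_le d.+1 (fun t => (coin_count (l :: ls) t)%:R : R).
  move=> l0 h; pose z (_ : R) : R := 0.
  have h' : growth_le d (fun t => (coin_count ls t)%:R - z t%:R).
    by case: h => B hB; exists B => t; rewrite subr0.
  have [B hB] : growth_le d.+1 (fun t => (coin_count (l :: ls) t)%:R - z t%:R).
    by apply: growth_le_step l0 h' _ => x; apply: subr0.
  by exists B => t; have := hB t; rewrite subr0.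
case: shape => [|l1 [|l2 [|l3 [|//]]]] //= _.
- by rewrite andbT => p1; apply: growth_leW (coin_count_single R p1).
- by rewrite andbT => /andP[p1 p2]; apply: (@growth_leW _ 2) => //;
    apply: step p1 (coin_count_single R p2).
by rewrite andbT => /and3P[p1 p2 p3]; apply: step p1 (step _ _ _ p2 (coin_count_single R p3)).
Qed.

Lemma few_cycles_approx2 shape : shape \in map fst class_sizes ->
  (0 < size shape <= 3)%N -> all (ltn 0) shape ->
  approx2 (fun a => (nb_fixed a (seq_perm (cycle_rep shape)))%:R : R) (fun=> 0).
Proof.
move=> /mapP[p pc ->] sz pos; have /andP[ps ids] := allP cycle_reps_okT _ pc.
have gr : growth_le 3 (shape_error p.1 (nseq 7 0)).
  have [B hB] := few_cycles_growth sz pos; exists B => t.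
  have -> : shape_error p.1 (nseq 7 0) t = (coin_count p.1 t)%:R.
    by rewrite /shape_error /peval /=; ring.
  exact: hB.
have [B [n h]] := nb_fixed_approx2 ps ids (size_nseq 7 (0 : R)) gr.
exists B, n => a /h; congr (`|_ - _| <= _).
by rewrite /binomial_top_terms /top_terms /=; ring.
Qed.

(** Turns a binary moment into a decimal literal, so that [field] never meets a large unary
    number. *)
Lemma natN_literal (v : N) u :
  N.of_num_uint u = v -> natN R v = (Nat.of_num_uint u)%:R.
Proof.
move=> <-; rewrite /natN.
congr (_%:R).
exact: (algebra_tactics.common.large_nat_N_nat (algebra_tactics.common.large_nat_uint u)).
Qed.

(** The first moment entry counts all linear families on seven points. Divided by 7! from Burnside
    and by 6! from the leading coefficient of [ones7], it is the coefficient of a^6. *)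
Lemma class_ones7 :
  approx2 (fun a => (nb_fixed a (seq_perm (cycle_rep [:: 1; 1; 1; 1; 1; 1; 1]%N)))%:R : R)
    (fun a => binomial_top_terms ones7
       (natN R 35406319%num) (natN R 334130658%num)
       (natN R 1481690854%num) (natN R 4111235296%num) a%:R).
Proof.
by apply: (@class_approx2 R _ 3); [vm_compute | | | | case=> [|[|[|[|[|[|[|]]]]]]] |
  apply: growth_leW error_ones7].
Qed.

Lemma class_two_ones5 :
  approx2 (fun a => (nb_fixed a (seq_perm (cycle_rep [:: 2; 1; 1; 1; 1; 1]%N)))%:R : R)
    (fun a => binomial_top_terms two_ones5
       (natN R 467121%num) (natN R 4472520%num) (natN R 20695684%num) (natN R 61655861%num) a%:R).
Proof.
by apply: (@class_approx2 R _ 2); [vm_compute | | | | case=> [|[|[|[|[|[|[|]]]]]]] |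
  apply: growth_leW error_two_ones5].
Qed.

Lemma class_twos2_ones3 :
  approx2 (fun a => (nb_fixed a (seq_perm (cycle_rep [:: 2; 2; 1; 1; 1]%N)))%:R : R)
    (fun a => binomial_top_terms twos2_ones3
       (natN R 53127%num) (natN R 505250%num) (natN R 2334821%num) (natN R 7000716%num) a%:R).
Proof.
by apply: (@class_approx2 R _ 1); [vm_compute | | | | case=> [|[|[|[|[|[|[|]]]]]]] |
  apply: growth_leW error_twos2_ones3].
Qed.

Lemma class_three_ones4 :
  approx2 (fun a => (nb_fixed a (seq_perm (cycle_rep [:: 3; 1; 1; 1; 1]%N)))%:R : R)
    (fun a => binomial_top_terms three_ones4
       (natN R 8785%num) (natN R 81144%num) (natN R 380263%num) (natN R 1202192%num) a%:R).
Proof.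
by apply: (@class_approx2 R _ 1); [vm_compute | | | | case=> [|[|[|[|[|[|[|]]]]]]] |
  apply: growth_leW error_three_ones4].
Qed.

Lemma class_twos3_one :
  approx2 (fun a => (nb_fixed a (seq_perm (cycle_rep [:: 2; 2; 2; 1]%N)))%:R : R)
    (fun a => binomial_top_terms twos3_one
       (natN R 18649%num) (natN R 176737%num) (natN R 823916%num) (natN R 2511796%num) a%:R).
Proof.
by apply: (@class_approx2 R _ 0); [vm_compute | | | | case=> [|[|[|[|[|[|[|]]]]]]] |
  apply: growth_leW error_twos3_one].
Qed.

Lemma class_three_two_ones2 :
  approx2 (fun a => (nb_fixed a (seq_perm (cycle_rep [:: 3; 2; 1; 1]%N)))%:R : R)
    (fun a => binomial_top_terms three_two_ones2
       (natN R 873%num) (natN R 8133%num) (natN R 41386%num) (natN R 146614%num) a%:R).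
Proof.
by apply: (@class_approx2 R _ 0); [vm_compute | | | | case=> [|[|[|[|[|[|[|]]]]]]] |
  apply: growth_leW error_three_two_ones2].
Qed.

Lemma class_four_ones3 :
  approx2 (fun a => (nb_fixed a (seq_perm (cycle_rep [:: 4; 1; 1; 1]%N)))%:R : R)
    (fun a => binomial_top_terms four_ones3
       (natN R 709%num) (natN R 6449%num) (natN R 32018%num) (natN R 110886%num) a%:R).
Proof.
by apply: (@class_approx2 R _ 0); [vm_compute | | | | case=> [|[|[|[|[|[|[|]]]]]]] |
  apply: growth_leW error_four_ones3].
Qed.

Lemma nb_rank3_lattices_approx2 :
  approx2 (fun a => (nb_rank3_lattices 7 a)%:R : R)
    (fun a => 35406319%:R / 3628800%:R * a%:R ^+ 6
     - 205303771%:R / 604800%:R * a%:R ^+ 5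
     + 986460817%:R / 181440%:R * a%:R ^+ 4
     - 908874965%:R / 18144%:R * a%:R ^+ 3).
Proof.
have few shape := @few_cycles_approx2 shape.
(* The summands and their factors follow the order of [class_sizes], so that both sides match term
   by term after expansion of the sum. *)
have H := approx2D class_ones7
 (approx2D (approx2Z 21%:R class_two_ones5)
 (approx2D (approx2Z 105%:R class_twos2_ones3)
 (approx2D (approx2Z 70%:R class_three_ones4)
 (approx2D (approx2Z 105%:R class_twos3_one)
 (approx2D (approx2Z 420%:R class_three_two_ones2)
 (approx2D (approx2Z 210%:R class_four_ones3)
 (approx2D (approx2Z 210%:R (few [:: 3; 2; 2]%N isT isT isT))
 (approx2D (approx2Z 280%:R (few [:: 3; 3; 1]%N isT isT isT))
 (approx2D (approx2Z 630%:R (few [:: 4; 2; 1]%N isT isT isT))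
 (approx2D (approx2Z 504%:R (few [:: 5; 1; 1]%N isT isT isT))
 (approx2D (approx2Z 420%:R (few [:: 4; 3]%N isT isT isT))
 (approx2D (approx2Z 504%:R (few [:: 5; 2]%N isT isT isT))
 (approx2D (approx2Z 840%:R (few [:: 6; 1]%N isT isT isT))
           (approx2Z 720%:R (few [:: 7]%N isT isT isT))))))))))))))).
have [B [n h]] := approx2Z 5040%:R^-1 H; exists B, n => a /h {h}.
have e : (nb_rank3_lattices 7 a)%:R * 5040%:R =
    \sum_(p <- class_sizes) p.2%:R * (nb_fixed a (seq_perm (cycle_rep p.1)))%:R :> R.
  rewrite -natrM burnside_7 natr_sum; apply: eq_bigr => p _; exact: natrM.
move: e; rewrite /class_sizes !big_cons big_nil => e.
congr (`|_ - _| <= _).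
  rewrite -[RHS](mulfK (x := 5040%:R)) ?pnatr_eq0 // e mulrC; congr (_ / _).
  by rewrite /fst /snd !mul1r addr0.
rewrite /binomial_top_terms /top_terms.
cbn [nth ones7 two_ones5 twos2_ones3 three_ones4 twos3_one three_two_ones2 four_ones3].
repeat match goal with |- context[natN R ?v] =>
  let u := eval vm_compute in (N.to_num_uint v) in
  rewrite (@natN_literal v u erefl) end.
by field.
Qed.
End CycleShapes.

From mathcomp Require Import all_classical all_reals.
From mathcomp Require Import topology normedtype landau.
Import GRing.Theory Num.Theory numFieldNormedType.Exports.
Local Open Scope ring_scope.
Local Open Scope classical_set_scope.

Theorem theorem7p8 (R : realType) :
  (fun a : nat => (nb_rank3_lattices 7 a)%:R : R) =
  (fun a : nat =>
     35406319%:R / 3628800%:R * a%:R ^+ 6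
     - 205303771%:R / 604800%:R * a%:R ^+ 5
     + 986460817%:R / 181440%:R * a%:R ^+ 4
     - 908874965%:R / 18144%:R * a%:R ^+ 3 : R)
  +O_\oo (fun a : nat => a%:R ^+ 2 : R).
Proof.
have [B [n h]] := nb_rank3_lattices_approx2 R.
(* Every constant above [|B|] is an admissible bound from the index [n] on. *)
apply/eqaddOP; exists `|B|; split; first exact: normr_real.
move=> k Bk; exists n => // a na; apply: le_trans (h a na) _.
rewrite [`|a%:R ^+ 2|]ger0_norm ?exprn_ge0 ?ler0n // ler_wpM2r ?exprn_ge0 ?ler0n //.
exact: le_trans (ler_norm B) (ltW Bk).
Qed.
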